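(* Let $k$ be a field of characteristic $p>0$ with $[k:k^p]<\infty$, let $S=k[x_0,\dots,x_n]$ with the standard grading, and let $\mathfrak{m}=(x_0,\dots,x_n)$. Let $f_1,\dots,f_c\in S$ be a homogeneous regular sequence, put $J=(f_1,\dots,f_c)$ and $R=S/J$. Suppose that $(f_1\cdots f_c)^{p-1}\notin\mathfrak{p}^{[p]}$ for every prime ideal $\mathfrak{p}\neq\mathfrak{m}$ of $S$ with $J\subseteq\mathfrak{p}$, but that $(f_1\cdots f_c)^{p-1}\in\mathfrak{m}^{[p]}$. Set $a(R)=-(n+1)+\sum_{i=1}^c\deg(f_i)$. Let $\tau$ be the smallest ideal of $S$ such that $J\subseteq\tau$ and $(f_1\cdots f_c)^{p-1}\in\tau^{[p]}$; in this case $\sqrt{\tau}=\mathfrak{m}$, and we set $\ell=\max\{s \mid \mathfrak{m}^s\not\subseteq\tau\}<\infty$. Then the Frobenius action $$F: H^{n+1-c}_{\mathfrak{m}}(R)_{<a(R)-\ell}\to H^{n+1-c}_{\mathfrak{m}}(R)_{<p(a(R)-\ell)}$$ is injective.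
   Context: For an ideal $I$ of $S$, $I^{[p]}=(a^p\mid a\in I)$ is the ideal generated by the $p$-th powers of elements of $I$. For a graded module $M$, $M_{<t}$ denotes $\bigoplus_{s<t}M_s$. The elements of the homogeneous regular sequence are homogeneous forms of positive degree. $H^i_{\mathfrak{m}}(R)$ is the $\mathbb{Z}$-graded local cohomology of $R$ with support in $\mathfrak{m}$, and the Frobenius action $F$ on it is the additive map induced by the Frobenius homomorphism $r\mapsto r^p$ of $R$; it sends elements of degree $t$ to elements of degree $pt$. *)

(* Defs.v *)
From HB Require Import structures.
From mathcomp Require Import all_boot all_order all_algebra.
From mathcomp Require Import ring.
From mathcomp Require Import boolp classical_sets.
From mathcomp Require Export mpoly.

Set Implicit Arguments.
Unset Strict Implicit.
Unset Printing Implicit Defensive.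

Import Order.TTheory GRing.Theory Num.Theory.

Local Open Scope classical_set_scope.
Local Open Scope ring_scope.
Local Open Scope quotient_scope.

(* The ideals of ring_quotient are proper by definition, hence a development
   without that restriction. *)

Section Ideals.
Variable S : comNzRingType.

Definition is_ideal (I : set S) : Prop :=
  [/\ I 0, forall a b, I a -> I b -> I (a + b) & forall a b, I b -> I (a * b)].

Record ideal := Ideal { ideal_mem :> S -> Prop; idealP : is_ideal ideal_mem }.

Definition ideal_le (I I' : ideal) : Prop := forall a, I a -> I' a.

Definition span_set (X : set S) : set S :=
  [set a | exists (N : nat) (g x : 'I_N -> S),
             (forall j, X (x j)) /\ a = \sum_(j < N) g j * x j].

Lemma span_subproof (X : set S) : is_ideal (span_set X).
Proof.
split=> [|a b [N [g [x [Xx ->]]]] [M [h [y [Xy ->]]]]|a b [N [g [x [Xx ->]]]]].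
- exists 0%N, (fun=> 0), (fun=> 0); split; first by case.
  by rewrite big_ord0.
- pose pick T (u : 'I_N -> T) (v : 'I_M -> T) (j : 'I_(N + M)) :=
    match split j with inl i => u i | inr i => v i end.
  exists (N + M)%N, (pick S g h), (pick S x y); split=> [j|].
    by rewrite /pick; case: (split j).
  rewrite big_split_ord /=; congr (_ + _); apply: eq_bigr => i _.
    by rewrite /pick (unsplitK (inl i)).
  by rewrite /pick (unsplitK (inr i)).
- exists N, (fun j => a * g j), x; split=> //.
  by rewrite mulr_sumr; apply: eq_bigr => j _; rewrite mulrA.
Qed.

Definition span (X : set S) : ideal := Ideal (span_subproof X).

Definition span_family (m : nat) (f : 'I_m -> S) : ideal := span (range f).

Definition ideal_pow (I : ideal) (s : nat) : ideal :=
  span [set a | exists g : 'I_s -> S,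
                  (forall j, I (g j)) /\ a = \prod_(j < s) g j].

Definition frobenius_power (p : nat) (I : ideal) : ideal :=
  span [set a ^+ p | a in (I : S -> Prop)].

Definition radical (I : ideal) : set S := [set a | exists s, I (a ^+ s)].

Definition prime_ideal (I : ideal) : Prop :=
  ~ I 1 /\ forall a b, I (a * b) -> I a \/ I b.

Definition regular_sequence (c : nat) (f : 'I_c -> S) : Prop :=
  ~ span_family f 1 /\
  forall (i : 'I_c) (a : S),
    span [set f j | j in [set j : 'I_c | (j < i)%N]] (f i * a) ->
    span [set f j | j in [set j : 'I_c | (j < i)%N]] a.

Definition smallest_ideal (P : ideal -> Prop) (I : ideal) : Prop :=
  P I /\ forall I', P I' -> ideal_le I I'.

End Ideals.

Definition is_max_nat (P : nat -> Prop) (l : nat) : Prop :=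
  P l /\ forall s, P s -> (s <= l)%N.

Definition finite_over_pth_powers (k : fieldType) (p : nat) : Prop :=
  exists (N : nat) (e : 'I_N -> k), forall y : k,
    exists a : 'I_N -> k, y = \sum_(j < N) a j ^+ p * e j.

Section QuotientRing.
Variables (S : comNzRingType) (J : ideal S).

Definition ideal_pred : {pred S} := fun a => `[< J a >].

Lemma ideal_predP a : reflect (J a) (a \in ideal_pred).
Proof. exact: asboolP. Qed.

Lemma ideal_pred_zmod_closed : zmod_closed ideal_pred.
Proof.
have [J0 JD JM] := idealP J; split; first exact/ideal_predP.
move=> a b /ideal_predP Ja /ideal_predP Jb; apply/ideal_predP.
by apply: JD => //; rewrite -mulN1r; apply: JM.
Qed.

HB.instance Definition _ :=
  GRing.isZmodClosed.Build S ideal_pred ideal_pred_zmod_closed.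

Definition quot_ring : Type := Quotient.quot ideal_pred.

HB.instance Definition _ := GRing.Zmodule.on quot_ring.

Definition quot_map (a : S) : quot_ring := \pi_(Quotient.quot ideal_pred) a.

Lemma quot_mapP (a b : S) : quot_map a = quot_map b <-> J (a - b).
Proof.
split=> [/eqP|Jab]; first by rewrite -Quotient.idealrBE => /ideal_predP.
by apply/eqP; rewrite -Quotient.idealrBE; apply/ideal_predP.
Qed.

Lemma quot_mapD : {morph quot_map : a b / a + b}.
Proof. by move=> a b; rewrite /quot_map !piE. Qed.

Lemma quot_map0 : quot_map 0 = 0.
Proof. by rewrite /quot_map !piE. Qed.

Definition quot_repr (u : quot_ring) : S := repr (u : Quotient.quot ideal_pred).

Lemma quot_reprK : cancel quot_repr quot_map.
Proof. by move=> u; rewrite /quot_map /quot_repr reprK. Qed.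

Definition quot_one : quot_ring := quot_map 1.
Definition quot_mul (u v : quot_ring) : quot_ring :=
  quot_map (quot_repr u * quot_repr v).

Lemma quot_mulE a b : quot_mul (quot_map a) (quot_map b) = quot_map (a * b).
Proof.
have [_ JD JM] := idealP J; apply/quot_mapP.
set a' := quot_repr _; set b' := quot_repr _.
have Ja : J (a' - a) by apply/quot_mapP; rewrite quot_reprK.
have Jb : J (b' - b) by apply/quot_mapP; rewrite quot_reprK.
have -> : a' * b' - a * b = b' * (a' - a) + a * (b' - b).
  by rewrite !mulrBr (mulrC b' a') (mulrC b' a) addrA addrNK.
by apply: JD; apply: JM.
Qed.

Lemma quot_mulA : associative quot_mul.
Proof.
move=> u v w; rewrite -(quot_reprK u) -(quot_reprK v) -(quot_reprK w).
by rewrite !quot_mulE mulrA.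
Qed.

Lemma quot_mulC : commutative quot_mul.
Proof. by move=> u v; rewrite /quot_mul mulrC. Qed.

Lemma quot_mul1 : left_id quot_one quot_mul.
Proof. by move=> u; rewrite -(quot_reprK u) quot_mulE mul1r. Qed.

Lemma quot_mulDl : left_distributive quot_mul +%R.
Proof.
move=> u v w; rewrite -(quot_reprK u) -(quot_reprK v) -(quot_reprK w).
by rewrite -quot_mapD !quot_mulE -quot_mapD mulrDl.
Qed.

HB.instance Definition _ := GRing.Zmodule_isComPzRing.Build quot_ring
  quot_mulA quot_mulC quot_mul1 quot_mulDl.

Lemma quot_map1 : quot_map 1 = 1. Proof. by []. Qed.

Lemma quot_mapM : {morph quot_map : a b / a * b}.
Proof. by move=> a b; rewrite -quot_mulE. Qed.

Lemma quot_map_nat m : quot_map m%:R = m%:R.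
Proof. by elim: m => [|m IH]; rewrite ?quot_map0 // !mulrS quot_mapD IH. Qed.

End QuotientRing.

#[local] Ltac xring := rewrite ?exprMn ?exprD ?expr0; ring.

(* [loc x] is A_x: the class [loc_frac x a k] of (a, k) is the fraction
   a / x^k. *)
Section Localization.
Variables (A : comPzRingType) (x : A).

Definition loc_equiv (u v : A * nat) : bool :=
  `[< exists N, x ^+ N * (x ^+ v.2 * u.1) = x ^+ N * (x ^+ u.2 * v.1) >].

Lemma loc_equiv_subproof : equiv_class_of loc_equiv.
Proof.
split=> [[a k]|[a k] [b l]|[b l] [a k] [c m]].
- by apply/asboolP; exists 0%N.
- by apply/asboolP/asboolP => -[N eN]; exists N.
- move=> /asboolP[N /= eN] /asboolP[M /= eM]; apply/asboolP.
  exists (N + M + l)%N => /=.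
  have -> : x ^+ (N + M + l) * (x ^+ m * a) =
      x ^+ M * x ^+ m * (x ^+ N * (x ^+ l * a)) by xring.
  rewrite eN.
  have -> : x ^+ (N + M + l) * (x ^+ k * c) =
      x ^+ N * x ^+ k * (x ^+ M * (x ^+ l * c)) by xring.
  by rewrite -eM; xring.
Qed.

Canonical loc_equiv_canonical := EquivRelPack loc_equiv_subproof.
Canonical loc_equiv_encModRel := defaultEncModRel loc_equiv.

Definition loc : Type := {eq_quot loc_equiv}.

HB.instance Definition _ := Choice.on loc.

Definition loc_frac (a : A) (k : nat) : loc := \pi_({eq_quot loc_equiv}) (a, k).

Definition loc_repr (u : loc) : A * nat := repr (u : {eq_quot loc_equiv}).

Lemma loc_fracP a k b l : loc_frac a k = loc_frac b l <->
  exists N, x ^+ N * (x ^+ l * a) = x ^+ N * (x ^+ k * b).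
Proof.
rewrite /loc_frac; split=> [/eqP|eN].
  by rewrite eqmodE => /asboolP.
by apply/eqP; rewrite eqmodE; apply/asboolP.
Qed.

Lemma loc_reprK u : loc_frac (loc_repr u).1 (loc_repr u).2 = u.
Proof. by rewrite /loc_frac -surjective_pairing /loc_repr reprK. Qed.

Lemma loc_fracE u : exists a k, u = loc_frac a k.
Proof. by exists (loc_repr u).1, (loc_repr u).2; rewrite loc_reprK. Qed.

Lemma loc_repr_frac a k : exists N,
  x ^+ N * (x ^+ k * (loc_repr (loc_frac a k)).1) =
  x ^+ N * (x ^+ (loc_repr (loc_frac a k)).2 * a).
Proof. by apply/loc_fracP; rewrite loc_reprK. Qed.

Definition loc_zero := loc_frac 0 0.
Definition loc_one := loc_frac 1 0.
Definition loc_opp (u : loc) := loc_frac (- (loc_repr u).1) (loc_repr u).2.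
Definition loc_add (u v : loc) :=
  let: (a, k) := loc_repr u in let: (b, l) := loc_repr v in
  loc_frac (x ^+ l * a + x ^+ k * b) (k + l).
Definition loc_mul (u v : loc) :=
  let: (a, k) := loc_repr u in let: (b, l) := loc_repr v in
  loc_frac (a * b) (k + l).

Lemma loc_oppE a k : loc_opp (loc_frac a k) = loc_frac (- a) k.
Proof.
have [N eN] := loc_repr_frac a k.
by apply/loc_fracP; exists N; rewrite !mulrN eN.
Qed.

Lemma loc_addE a k b l : loc_add (loc_frac a k) (loc_frac b l) =
  loc_frac (x ^+ l * a + x ^+ k * b) (k + l).
Proof.
have [N] := loc_repr_frac a k; have [M] := loc_repr_frac b l; rewrite /loc_add.
case: loc_repr => b' l' /= eM; case: loc_repr => a' k' /= eN.
apply/loc_fracP; exists (N + M)%N.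
transitivity (x ^+ M * x ^+ l * x ^+ l' * (x ^+ N * (x ^+ k * a')) +
   x ^+ N * x ^+ k * x ^+ k' * (x ^+ M * (x ^+ l * b'))); first by xring.
by rewrite eN eM; xring.
Qed.

Lemma loc_mulE a k b l :
  loc_mul (loc_frac a k) (loc_frac b l) = loc_frac (a * b) (k + l).
Proof.
have [N] := loc_repr_frac a k; have [M] := loc_repr_frac b l; rewrite /loc_mul.
case: loc_repr => b' l' /= eM; case: loc_repr => a' k' /= eN.
apply/loc_fracP; exists (N + M)%N.
transitivity ((x ^+ N * (x ^+ k * a')) * (x ^+ M * (x ^+ l * b'))); first by xring.
by rewrite eN eM; xring.
Qed.

Lemma loc_addA : associative loc_add.
Proof.
move=> u v w; have [a [k ->]] := loc_fracE u; have [b [l ->]] := loc_fracE v.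
have [c [m ->]] := loc_fracE w; rewrite !loc_addE.
by apply/loc_fracP; exists 0%N; xring.
Qed.

Lemma loc_addC : commutative loc_add.
Proof.
move=> u v; have [a [k ->]] := loc_fracE u; have [b [l ->]] := loc_fracE v.
by rewrite !loc_addE; apply/loc_fracP; exists 0%N; xring.
Qed.

Lemma loc_add0 : left_id loc_zero loc_add.
Proof.
move=> u; have [a [k ->]] := loc_fracE u.
by rewrite loc_addE; apply/loc_fracP; exists 0%N; xring.
Qed.

Lemma loc_addN : left_inverse loc_zero loc_opp loc_add.
Proof.
move=> u; have [a [k ->]] := loc_fracE u.
by rewrite loc_oppE loc_addE; apply/loc_fracP; exists 0%N; xring.
Qed.

HB.instance Definition _ :=
  GRing.isZmodule.Build loc loc_addA loc_addC loc_add0 loc_addN.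

Lemma loc_mulA : associative loc_mul.
Proof.
move=> u v w; have [a [k ->]] := loc_fracE u; have [b [l ->]] := loc_fracE v.
have [c [m ->]] := loc_fracE w; rewrite !loc_mulE.
by apply/loc_fracP; exists 0%N; xring.
Qed.

Lemma loc_mulC : commutative loc_mul.
Proof.
move=> u v; have [a [k ->]] := loc_fracE u; have [b [l ->]] := loc_fracE v.
by rewrite !loc_mulE; apply/loc_fracP; exists 0%N; xring.
Qed.

Lemma loc_mul1 : left_id loc_one loc_mul.
Proof.
move=> u; have [a [k ->]] := loc_fracE u.
by rewrite loc_mulE; apply/loc_fracP; exists 0%N; xring.
Qed.

Lemma loc_mulDl : left_distributive loc_mul loc_add.
Proof.
move=> u v w; have [a [k ->]] := loc_fracE u; have [b [l ->]] := loc_fracE v.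
have [c [m ->]] := loc_fracE w; rewrite loc_addE !loc_mulE loc_addE.
by apply/loc_fracP; exists 0%N; xring.
Qed.

HB.instance Definition _ := GRing.Zmodule_isComPzRing.Build loc
  loc_mulA loc_mulC loc_mul1 loc_mulDl.

Lemma loc_frac0 k : loc_frac 0 k = 0.
Proof. by apply/loc_fracP; exists 0%N; xring. Qed.

Lemma loc_fracD a k b l : loc_frac a k + loc_frac b l =
  loc_frac (x ^+ l * a + x ^+ k * b) (k + l).
Proof. exact: loc_addE. Qed.

Lemma loc_fracN a k : - loc_frac a k = loc_frac (- a) k.
Proof. exact: loc_oppE. Qed.

Lemma loc_fracM a k b l : loc_frac a k * loc_frac b l = loc_frac (a * b) (k + l).
Proof. exact: loc_mulE. Qed.

Lemma loc_fracX a k p : loc_frac a k ^+ p = loc_frac (a ^+ p) (k * p).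
Proof.
elim: p => [|p IH]; first by rewrite !expr0 muln0.
by rewrite !exprS IH loc_fracM mulnS.
Qed.

Lemma loc_nat m : m%:R = loc_frac m%:R 0.
Proof.
elim: m => [|m IH] //; rewrite mulrS IH loc_fracD.
by apply/loc_fracP; exists 0%N; rewrite -natr1; xring.
Qed.

End Localization.

(* The canonical map A_x -> A_y for y = x * z; outside that case it is
   meaningless. *)
Definition loc_map (A : comPzRingType) (x y z : A) (u : loc x) : loc y :=
  let: (a, k) := loc_repr u in loc_frac y (a * z ^+ k) k.

Section LocMap.
Variables (A : comPzRingType) (x y z : A).
Hypothesis exz : y = x * z.

Lemma loc_mapE a k :
  loc_map y z (loc_frac x a k) = loc_frac y (a * z ^+ k) k.
Proof.
have [N] := loc_repr_frac x a k; rewrite /loc_map.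
case: loc_repr => a' k' /= eN; apply/loc_fracP; exists N; rewrite exz.
transitivity (z ^+ N * z ^+ k * z ^+ k' * (x ^+ N * (x ^+ k * a'))); first by xring.
by rewrite eN; xring.
Qed.

Lemma loc_mapD : {morph @loc_map A x y z : u v / u + v}.
Proof.
move=> u v; have [a [k ->]] := loc_fracE u; have [b [l ->]] := loc_fracE v.
rewrite loc_fracD !loc_mapE loc_fracD.
by apply/loc_fracP; exists 0%N; rewrite exz; xring.
Qed.

Lemma loc_mapN : {morph @loc_map A x y z : u / - u}.
Proof.
move=> u; have [a [k ->]] := loc_fracE u.
by rewrite loc_fracN !loc_mapE loc_fracN mulNr.
Qed.

Lemma loc_map_sum I (r : seq I) (P : pred I) (F : I -> loc x) :
  loc_map y z (\sum_(i <- r | P i) F i) =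
  \sum_(i <- r | P i) loc_map y z (F i).
Proof.
apply: (big_morph _ loc_mapD).
by rewrite -(loc_frac0 x 0) loc_mapE mul0r loc_frac0.
Qed.

Lemma loc_mapX p : {morph @loc_map A x y z : u / u ^+ p}.
Proof.
move=> u; have [a [k ->]] := loc_fracE u; rewrite loc_fracX !loc_mapE loc_fracX.
by congr loc_frac; rewrite exprMn exprM.
Qed.

End LocMap.

Lemma loc_map_comp (A : comPzRingType) (x y w z z' : A) (u : loc x) :
  y = x * z -> w = y * z' ->
  loc_map w z' (loc_map y z u) = loc_map w (z * z') u.
Proof.
move=> exy eyw; have [a [k ->]] := loc_fracE u.
rewrite (loc_mapE exy) (loc_mapE eyw) (@loc_mapE _ x w (z * z')).
  by rewrite exprMn mulrA.
by rewrite eyw exy mulrA.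
Qed.

Section Cech.
Variables (A : comPzRingType) (m : nat) (x : 'I_m -> A).

Definition cech_prod (I : {set 'I_m}) : A := \prod_(i in I) x i.

(* The sum over all i of the terms
     C^i = \bigoplus_(#|I| = i) A_(x_I),   x_I = \prod_(j in I) x j,
   of the Cech complex of A on x; C^i is cut out by [cochain_degree i]. *)
Definition cochain : Type := forall I : {set 'I_m}, loc (cech_prod I).

HB.instance Definition _ := gen_eqMixin cochain.
HB.instance Definition _ := gen_choiceMixin cochain.

Definition cochain_zero : cochain := fun=> 0.
Definition cochain_opp (b : cochain) : cochain := fun I => - b I.
Definition cochain_add (b c : cochain) : cochain := fun I => b I + c I.

Lemma cochain_addA : associative cochain_add.
Proof. by move=> a b c; apply: functional_extensionality_dep => I; exact: addrA. Qed.

Lemma cochain_addC : commutative cochain_add.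
Proof. by move=> a b; apply: functional_extensionality_dep => I; exact: addrC. Qed.

Lemma cochain_add0 : left_id cochain_zero cochain_add.
Proof. by move=> a; apply: functional_extensionality_dep => I; exact: add0r. Qed.

Lemma cochain_addN : left_inverse cochain_zero cochain_opp cochain_add.
Proof. by move=> a; apply: functional_extensionality_dep => I; exact: addNr. Qed.

HB.instance Definition _ := GRing.isZmodule.Build cochain
  cochain_addA cochain_addC cochain_add0 cochain_addN.

Definition cochain_degree (i : nat) (c : cochain) : Prop :=
  forall I : {set 'I_m}, #|I| != i -> c I = 0.

Definition cech_sign (I : {set 'I_m}) (j : 'I_m) : nat :=
  #|[set i in I | (i < j)%N]|.

Definition cech_d (c : cochain) : cochain := fun I =>
  \sum_(j in I) (-1) ^+ cech_sign I j * loc_map (cech_prod I) (x j) (c (I :\ j)).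

Lemma cech_prodD1 (I : {set 'I_m}) j :
  j \in I -> cech_prod I = cech_prod (I :\ j) * x j.
Proof. by move=> jI; rewrite /cech_prod (big_setD1 j) //= mulrC. Qed.

Lemma cech_d_is_zmod_morphism : zmod_morphism cech_d.
Proof.
move=> b c; apply: functional_extensionality_dep => I.
rewrite [RHS]/(_ - _)/= -[RHS]/(cech_d b I - cech_d c I) /cech_d -sumrB.
apply: eq_bigr => j jI; rewrite -mulrBr; congr (_ * _).
apply: (addIr (loc_map (cech_prod I) (x j) (c (I :\ j)))); rewrite subrK.
by rewrite -(loc_mapD (cech_prodD1 jI)) subrK.
Qed.

HB.instance Definition _ :=
  GRing.isZmodMorphism.Build cochain cochain cech_d cech_d_is_zmod_morphism.

Lemma cech_sign_lt (I : {set 'I_m}) (i j : 'I_m) :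
  i \in I -> (i < j)%N -> cech_sign I j = (cech_sign (I :\ i) j).+1.
Proof.
move=> iI ij; rewrite /cech_sign (cardsD1 i) inE iI ij add1n; congr _.+1.
by apply: eq_card => h; rewrite !inE andbA.
Qed.

Lemma cech_sign_gt (I : {set 'I_m}) (i j : 'I_m) :
  (i < j)%N -> cech_sign (I :\ j) i = cech_sign I i.
Proof.
move=> ij; apply: eq_card => h; rewrite !inE.
by case: eqP => //= ->; rewrite ltnNge (ltnW ij) andbF.
Qed.

Lemma cech_d2 (c : cochain) : cech_d (cech_d c) = 0.
Proof.
apply: functional_extensionality_dep => I; rewrite -[RHS]/0.
pose M j i := loc_map (cech_prod I) (x i * x j) (c (I :\ j :\ i)).
pose T j i := (-1) ^+ (cech_sign I j + cech_sign (I :\ j) i) * M j i.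
have -> : cech_d (cech_d c) I =
    \sum_(j in I) \sum_(i in I | i != j) T j i.
  apply: eq_bigr => j jI; have eI := cech_prodD1 jI.
  rewrite (loc_map_sum eI) mulr_sumr; apply: eq_big => i.
    by rewrite !inE andbC.
  move=> iIj; rewrite /T exprD -mulrA; congr (_ * _).
  rewrite -signr_odd -[in RHS]signr_odd !mulr_sign.
  by case: odd; rewrite ?(loc_mapN eI) (loc_map_comp _ (cech_prodD1 iIj) eI).
have Tanti j i : j \in I -> i \in I -> (i < j)%N -> T j i = - T i j.
  move=> jI iI ij; rewrite /T (cech_sign_lt iI ij) (cech_sign_gt I ij).
  rewrite addSn exprS mulN1r mulNr addnC; congr (- (_ * _)).
  rewrite /M mulrC; suff -> : I :\ j :\ i = I :\ i :\ j by [].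
  by apply/setP => h; rewrite !inE andbCA.
have -> : \sum_(j in I) \sum_(i in I | i != j) T j i =
    \sum_(j in I) \sum_(i in I | (i < j)%N) T j i +
    \sum_(j in I) \sum_(i in I | (j < i)%N) T j i.
  rewrite -big_split; apply: eq_bigr => j jI /=.
  rewrite (bigID (fun i : 'I_m => (i < j)%N)) /=.
  by congr (_ + _); apply: eq_bigl => i; rewrite -val_eqE /=; case: ltngtP;
    rewrite ?andbT ?andbF.
rewrite [X in _ + X](exchange_big_dep (mem I)) /=; last by move=> ? ? _ /andP[].
rewrite -big_split big1 //= => j jI.
rewrite (eq_bigr (fun i => - T i j)); last first.
  by move=> i /andP[iI ij]; rewrite Tanti.
rewrite sumrN addrC; apply/eqP; rewrite subr_eq0; apply/eqP.
by apply: eq_bigl => i; rewrite jI.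
Qed.

Lemma cochain_degree_zmod i (b c : cochain) :
  cochain_degree i b -> cochain_degree i c -> cochain_degree i (b - c).
Proof.
move=> ib ic I iI; rewrite -[LHS]/(b I - c I).
by rewrite ib // ic // subrr.
Qed.

Definition cocycle_pred (i : nat) : {pred cochain} :=
  fun c => `[< cochain_degree i c /\ cech_d c = 0 >].

Lemma cocycle_zmod_closed i : zmod_closed (cocycle_pred i).
Proof.
split; first by apply/asboolP; split=> //; rewrite raddf0.
move=> b c /asboolP[ib zb] /asboolP[ic zc]; apply/asboolP.
by split; [exact: cochain_degree_zmod|rewrite raddfB /= zb zc subrr].
Qed.

HB.instance Definition _ i :=
  GRing.isZmodClosed.Build cochain (cocycle_pred i) (cocycle_zmod_closed i).

Record cocycle (i : nat) : Type :=
  Cocycle { cocycle_val : cochain; _ : cocycle_val \in cocycle_pred i }.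

HB.instance Definition _ i := [isSub for @cocycle_val i].
HB.instance Definition _ i := [Choice of cocycle i by <:].
HB.instance Definition _ i := [SubChoice_isSubZmodule of cocycle i by <:].

(* For i = 0 the condition forces b = 0. *)
Definition coboundary_pred (i : nat) : {pred cocycle i} := fun c =>
  `[< exists b : cochain,
        (forall I : {set 'I_m}, #|I|.+1 != i -> b I = 0) /\ cocycle_val c = cech_d b >].

Lemma coboundary_zmod_closed i : zmod_closed (@coboundary_pred i).
Proof.
split; first by apply/asboolP; exists 0; split=> //; rewrite raddf0.
move=> c c' /asboolP[b [ib cb]] /asboolP[b' [ib' cb']]; apply/asboolP.
exists (b - b'); split=> [I iI|]; last by rewrite raddfB /= -cb -cb'.
by rewrite -[LHS]/(b I - b' I) ib // ib' // subrr.
Qed.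

HB.instance Definition _ i :=
  GRing.isZmodClosed.Build (cocycle i) (@coboundary_pred i)
    (@coboundary_zmod_closed i).

(* H^i of the Cech complex of A on x, i.e. the local cohomology of A with
   support in the ideal generated by x when A is noetherian. *)
Definition cohomology (i : nat) : Type := Quotient.quot (@coboundary_pred i).

HB.instance Definition _ i := GRing.Zmodule.on (cohomology i).

Definition cohomology_class (i : nat) (c : cocycle i) : cohomology i :=
  \pi_(Quotient.quot (@coboundary_pred i)) c.

Definition cohomology_repr (i : nat) (h : cohomology i) : cocycle i :=
  repr (h : Quotient.quot (@coboundary_pred i)).

Lemma cohomology_classP i (c c' : cocycle i) :
  cohomology_class c = cohomology_class c' <-> c - c' \in @coboundary_pred i.
Proof.
rewrite Quotient.idealrBE; split=> [e|/eqP //].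
by apply/eqP.
Qed.

Lemma cohomology_reprK i : cancel (@cohomology_repr i) (@cohomology_class i).
Proof. by move=> h; rewrite /cohomology_class /cohomology_repr reprK. Qed.

Lemma cohomology_class_is_zmod_morphism i : zmod_morphism (@cohomology_class i).
Proof. by move=> c c'; rewrite /cohomology_class !piE. Qed.

HB.instance Definition _ i :=
  GRing.isZmodMorphism.Build (cocycle i) (cohomology i) (@cohomology_class i)
    (@cohomology_class_is_zmod_morphism i).

End Cech.

(* ssralg has [pchar] only for nontrivial rings, while a quotient ring may be
   trivial. *)
Definition char_p (A : pzRingType) (p : nat) : Prop := prime p /\ p%:R = 0 :> A.

Lemma pth_power_is_zmod_morphism (A : comPzRingType) (p : nat) :
  char_p A p -> zmod_morphism (fun a : A => a ^+ p).
Proof.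
move=> [pr_p p0] a b; have p_gt0 := prime_gt0 pr_p.
suff D (u v : A) : (u + v) ^+ p = u ^+ p + v ^+ p.
  by apply: (addIr (b ^+ p)); rewrite -D !subrK.
case: p pr_p p0 p_gt0 => // q pr_p p0 _.
rewrite exprDn big_ord_recr big_ord_recl /= subnn bin0 binn !expr0 mul1r mulr1.
rewrite big1 ?addr0 // => i _; have : (q.+1 %| 'C(q.+1, lift ord0 i))%N.
  by apply: prime_dvd_bin => //; rewrite /= ltnS ltn_ord.
by case/dvdnP=> r ->; rewrite -mulr_natr natrM p0 !mulr0.
Qed.

Section Frobenius.
Variables (A : comPzRingType) (m : nat) (x : 'I_m -> A) (p : nat).
Hypothesis pA : char_p A p.

Lemma loc_char_p (y : A) : char_p (loc y) p.
Proof. by have [pr_p p0] := pA; split=> //; rewrite loc_nat p0 loc_frac0. Qed.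

Definition cochain_frobenius (c : cochain x) : cochain x := fun I => c I ^+ p.

Lemma cochain_frobenius_is_zmod_morphism : zmod_morphism cochain_frobenius.
Proof.
move=> b c; apply: functional_extensionality_dep => I.
exact: (pth_power_is_zmod_morphism (loc_char_p _)).
Qed.

HB.instance Definition _ := GRing.isZmodMorphism.Build _ _ cochain_frobenius
  cochain_frobenius_is_zmod_morphism.

Lemma cochain_frobenius_d (c : cochain x) :
  cochain_frobenius (cech_d c) = cech_d (cochain_frobenius c).
Proof.
apply: functional_extensionality_dep => I.
pose phi : loc (cech_prod x I) -> loc (cech_prod x I) := fun u => u ^+ p.
pose phiM := GRing.isZmodMorphism.Build _ _ phi
  (pth_power_is_zmod_morphism (loc_char_p _)).
pose Phi : {additive loc (cech_prod x I) -> loc (cech_prod x I)} :=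
  HB.pack phi phiM.
rewrite /cochain_frobenius /cech_d -[LHS]/(Phi _) raddf_sum.
apply: eq_bigr => j jI; rewrite -signr_odd !mulr_sign.
by case: odd; rewrite ?raddfN /= /phi (loc_mapX (cech_prodD1 _ jI)).
Qed.

Lemma cocycle_frobenius_subproof i (c : cocycle x i) :
  cochain_frobenius (cocycle_val c) \in cocycle_pred i.
Proof.
case: c => c /= /asboolP[ic zc]; apply/asboolP; split.
  move=> I iI; rewrite /cochain_frobenius ic // expr0n.
  by have [/prime_gt0] := pA; case: p.
by rewrite -cochain_frobenius_d zc raddf0.
Qed.

Definition cocycle_frobenius i (c : cocycle x i) : cocycle x i :=
  Cocycle (cocycle_frobenius_subproof c).

Definition cohomology_frobenius i (h : cohomology x i) : cohomology x i :=
  cohomology_class (cocycle_frobenius (cohomology_repr h)).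

Lemma cohomology_frobeniusE i (c : cocycle x i) :
  cohomology_frobenius (cohomology_class c) =
  cohomology_class (cocycle_frobenius c).
Proof.
have /cohomology_classP/asboolP[b [ib]] :
  cohomology_class (cohomology_repr (cohomology_class c)) = cohomology_class c.
  by rewrite cohomology_reprK.
set c' := cohomology_repr _ => /= cb; apply/cohomology_classP/asboolP.
exists (cochain_frobenius b); split=> [I iI|].
  by rewrite /cochain_frobenius ib // expr0n; have [/prime_gt0] := pA; case: p.
by rewrite -cochain_frobenius_d -cb !raddfB.
Qed.

Lemma cohomology_frobenius_is_zmod_morphism i :
  zmod_morphism (@cohomology_frobenius i).
Proof.
move=> h h'; rewrite -(cohomology_reprK h) -(cohomology_reprK h').
rewrite -raddfB !cohomology_frobeniusE -raddfB; congr cohomology_class.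
by apply: val_inj; rewrite /= -raddfB.
Qed.

HB.instance Definition _ i := GRing.isZmodMorphism.Build _ _
  (@cohomology_frobenius i) (@cohomology_frobenius_is_zmod_morphism i).

End Frobenius.

Section Grading.
Variables (A : comPzRingType) (G : nat -> set A) (m : nat) (x : 'I_m -> A).

(* The piece of degree t of A_y, where [G s] is the piece of degree s of A and y
   is homogeneous of degree e. The case u = 0 matters when e = 0 and t < 0. *)
Definition loc_piece (y : A) (e : nat) (t : int) : set (loc y) :=
  [set u | u = 0 \/
     exists k s a, [/\ G s a, s%:Z = t + (k * e)%:Z & u = loc_frac y a k]].

(* The x j are assumed homogeneous of degree 1, so x_I has degree #|I|. *)
Definition cohomology_piece (i : nat) (t : int) : set (cohomology x i) :=
  [set h | exists c : cocycle x i,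
     (forall I : {set 'I_m}, loc_piece #|I| t (cocycle_val c I)) /\ h = cohomology_class c].

End Grading.

Definition truncation (M : zmodType) (piece : int -> set M) (t : int) : set M :=
  [set h | exists (N : nat) (s : 'I_N -> int) (g : 'I_N -> M),
     (forall j, s j < t /\ piece (s j) (g j)) /\ h = \sum_(j < N) g j].

Section PolynomialQuotient.
Variables (k : fieldType) (n : nat).
Local Notation S := {mpoly k[n]}.

Definition irrelevant_ideal : ideal S := span_family (fun i : 'I_n => 'X_i).

Definition quot_piece (J : ideal S) (s : nat) : set (quot_ring J) :=
  [set quot_map J a | a in [set a : S | a \is s.-homog]].

Definition quot_var (J : ideal S) (i : 'I_n) : quot_ring J := quot_map J 'X_i.

Lemma quot_char_p (J : ideal S) (p : nat) :
  p \in [pchar k] -> char_p (quot_ring J) p.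
Proof.
move=> /andP[pr_p /eqP p0]; split=> //.
by rewrite -quot_map_nat -(mpolyC_nat n k) p0 mpolyC0 quot_map0.
Qed.

Definition local_cohomology (J : ideal S) (i : nat) : zmodType :=
  cohomology (quot_var J) i.

Definition local_cohomology_lt (J : ideal S) (i : nat) (t : int) :
    set (local_cohomology J i) :=
  truncation (cohomology_piece (@quot_piece J) (x := quot_var J) (i := i)) t.

Definition frobenius_action (J : ideal S) (p : nat) (hp : p \in [pchar k])
    (i : nat) : local_cohomology J i -> local_cohomology J i :=
  @cohomology_frobenius _ _ (quot_var J) p (quot_char_p J hp) i.

End PolynomialQuotient.

(* Main.v *)
From HB Require Import structures.
Require Import Defs.
From mathcomp Require Import all_boot all_order all_algebra.
From mathcomp Require Import ring zify.
From mathcomp Require Import boolp classical_sets.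

Set Implicit Arguments.
Unset Strict Implicit.
Unset Printing Implicit Defensive.

Import Order.TTheory GRing.Theory Num.Theory.
Local Open Scope ring_scope.

(** Let N be the number of variables, C the Cech complex of the polynomial ring
    S on the variables, and J_i = (f_1, ..., f_i), so that J = J_c.

    The connecting maps of 0 -> S/J_(i-1) -> S/J_(i-1) -> S/J_i -> 0, where the
    first arrow is multiplication by f_i, compose to a map
      H^(N-c)(S/J) -> H^(N-c+1)(S/J_(c-1)) -> ... -> H^N(S)
    that lowers degrees by the sum of the degrees of the f_i. It is injective
    because H^j(S/J_i) = 0 for j + i < N ([acyclic_mod_regular]), which rests on
    H^j(S) = 0 for j < N ([cech_acyclic]), and its image is killed by J. From
    d z = f_i w follows d (z^p) = f_i (f_i^(p-1) w^p), so the map takes the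
    Frobenius action of S/J to g F, where F is the Frobenius action on H^N(S)
    and g = (f_1 ... f_c)^(p-1) ([connected_frobenius]).

    In H^N(S) everything is explicit: a fraction a / (x_1 ... x_N)^d is zero
    exactly when a lies in (x_1^d, ..., x_N^d). Let h be a class with F h = 0, let
    a / (x_1 ... x_N)^d be its image, and let I be the annihilator of that image.
    Then J is contained in I, and g a^p lies in (x_1^(dp), ..., x_N^(dp)). Now S is
    free over S^p, with basis the products of a basis of k over k^p and of the
    monomials with exponents less than p. If b^p is a coordinate of g, then
    (a b)^p is one of g a^p, so a b lies in (x_1^d, ..., x_N^d) and b in I. Hence g
    lies in I^[p]. By minimality tau is contained in I, so I contains
    m^s for all s > l. A nonzero element of H^N(S) killed by those powers has a
    component of degree at least -N - l, which the bound on the degree of h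
    excludes; so the image of h is zero, and h = 0.

    The same coordinates show that tau exists: it is generated by J and the p-th
    roots of the coordinates of g. Its radical is m because a prime containing tau
    but not m would satisfy g in P^[p]. *)

(** * Complexes modulo the initial segments of a regular sequence *)

Definition submodule (S : pzRingType) (C : lmodType S) (P : C -> Prop) : Prop :=
  P 0 /\ forall a u v, P u -> P v -> P (a *: u + v).

Section Submodule.
Variables (S : pzRingType) (C : lmodType S) (P : C -> Prop).
Hypothesis subP : submodule P.

Lemma submodule0 : P 0. Proof. by have [] := subP. Qed.

Lemma submoduleZ a u : P u -> P (a *: u).
Proof. by move=> Pu; rewrite -[_ *: _]addr0; apply: subP.2 => //; apply: submodule0. Qed.

Lemma submoduleD u v : P u -> P v -> P (u + v).
Proof. by move=> Pu Pv; rewrite -[u]scale1r; apply: subP.2. Qed.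

Lemma submoduleB u v : P u -> P v -> P (u - v).
Proof.
by move=> Pu Pv; apply: submoduleD => //; rewrite -scaleN1r; apply: submoduleZ.
Qed.

End Submodule.

Section Complex.
Variables (S : comNzRingType) (C : lmodType S) (d : {linear C -> C}).
Variables (E : nat -> C -> Prop) (f : nat -> S) (l : nat) (M : nat -> C -> Prop).

(** Here [M i] stands for the subcomplex (f_0, ..., f_(i-1)) C, and [E j.+1] for
    the cochains of degree [j]: the shift provides a zero piece [E 0] in degree -1,
    so that degree 0 is not an exception. *)
Record complex_mod_sequence : Prop := ComplexModSequence {
  complex_d2 : forall z, d (d z) = 0;
  complex_E : forall j, submodule (E j);
  complex_E0 : forall z, E 0 z -> z = 0;
  complex_Ed : forall j z, E j z -> E j.+1 (d z);
  complex_M : forall i, submodule (M i);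
  complex_Md : forall i z, M i z -> M i (d z);
  complex_M_scale : forall i z, M i.+1 (f i *: z);
  complex_M_le : forall i z, M i z -> M i.+1 z;
  complex_M_split : forall i j z, M i.+1 z -> E j z ->
    exists2 w, E j w & M i (z - f i *: w);
  complex_M_reg : forall i z, (i < l)%N -> M i (f i *: z) -> M i z }.

Hypothesis cplx : complex_mod_sequence.
Let d2 := complex_d2 cplx.
Let EP := complex_E cplx.
Let E0 := complex_E0 cplx.
Let Ed := complex_Ed cplx.
Let MP := complex_M cplx.
Let Md := complex_Md cplx.
Let MS := complex_M_scale cplx.
Let Mle := complex_M_le cplx.
Let Msplit := complex_M_split cplx.
Let Mreg := complex_M_reg cplx.

Definition coboundary_mod (i j : nat) (z : C) : Prop :=
  exists2 b, E j b & M i (z - d b).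

Definition acyclic_mod (i j : nat) : Prop :=
  forall z, E j.+1 z -> M i (d z) -> coboundary_mod i j z.

Lemma d_correction u b w a : d (u - d b - a *: w) = d u - a *: d w.
Proof. by rewrite linearB linearZ /= linearB d2 subr0. Qed.

(** The common step of the diagram chases along
    0 -> C/M_i -> C/M_i -> C/M_(i+1) -> 0: when d z = f_i w and w is a coboundary
    d b modulo M_i, the cochain z - f_i b is a cocycle modulo M_i, to which
    acyclicity applies. *)
Lemma coboundary_mod_lift i j w z b :
  acyclic_mod i j -> E j.+1 z -> E j.+1 b ->
  M i (d z - f i *: w) -> M i (w - d b) -> coboundary_mod i j (z - f i *: b).
Proof.
move=> ac Ez Eb Mz Mw; apply: ac.
  by apply: (submoduleB (EP _)) => //; apply: (submoduleZ (EP _)).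
rewrite linearB linearZ /=.
have -> : d z - f i *: d b = (d z - f i *: w) + f i *: (w - d b).
  by rewrite scalerBr addrA subrK.
by apply: (submoduleD (MP i)) => //; apply: (submoduleZ (MP i)).
Qed.

Lemma coboundary_mod_next i j z b :
  coboundary_mod i j (z - f i *: b) -> coboundary_mod i.+1 j z.
Proof.
move=> [u Eu Mu]; exists u => //.
have -> : z - d u = (z - f i *: b - d u) + f i *: b by rewrite addrAC subrK.
apply: (submoduleD (MP _)); [exact: Mle|exact: MS].
Qed.

(** From d (d z) = 0 one gets f_i (d w) in M_i, and f_i is regular modulo M_i. *)
Lemma quotient_cocycle i z w : (i < l)%N -> M i (d z - f i *: w) -> M i (d w).
Proof.
move=> il /Md; rewrite linearB d2 sub0r => /(submoduleZ (MP i) (-1)).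
by rewrite scaleN1r opprK linearZ; apply: Mreg.
Qed.

Lemma divide_cocycle i j z : (i < l)%N -> E j z -> M i.+1 (d z) ->
  exists w, [/\ E j.+1 w, M i (d z - f i *: w) & M i (d w)].
Proof.
move=> il Ez Mz; have [w Ew Mw] := Msplit Mz (Ed Ez); exists w; split=> //.
exact: quotient_cocycle Mw.
Qed.

(** Each further element of the regular sequence costs one degree of vanishing,
    by the long exact sequence of multiplication by f_i on C/M_i. *)
Lemma acyclic_mod_regular N : (forall j, (j < N)%N -> acyclic_mod 0 j) ->
  forall i j, (i <= l)%N -> (j + i < N)%N -> acyclic_mod i j.
Proof.
move=> ac0; elim=> [|i IH] j il jiN; first by apply: ac0; rewrite addn0 in jiN.
move=> z Ez Mz; have [w [Ew Mw Mdw]] := divide_cocycle il Ez Mz.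
have [|b Eb Mb] := IH j.+1 (ltnW il) _ w Ew Mdw; first by rewrite addSnnS.
apply: (@coboundary_mod_next _ _ _ b); apply: (coboundary_mod_lift _ _ _ Mw Mb) => //.
by apply: IH; lia.
Qed.

(** Modulo M_(i+1) the vanishing is known one degree lower, so f_i is injective
    on the cohomology of C/M_i in degree j. A class killed by a power of f_i is
    then zero. *)
Lemma acyclic_mod_torsion :
  (forall i j z, (i < l)%N -> E j.+1 z -> M i (d z) ->
     exists e, coboundary_mod i j (f i ^+ e *: z)) ->
  forall i j, (j + i < l)%N -> acyclic_mod i j.
Proof.
move=> tors.
have reduce i j : (i < l)%N ->
    (forall y, E j.+1 y -> M i (d y) ->
       coboundary_mod i j (f i *: y) -> coboundary_mod i j y) ->
    acyclic_mod i j.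
  move=> il divide z Ez Mz; have [e] := tors i j z il Ez Mz.
  elim: e => [|e IHe]; first by rewrite expr0 scale1r.
  rewrite exprS -scalerA => /divide fz; apply: IHe; apply: fz.
    exact: (submoduleZ (EP _)).
  by rewrite linearZ; apply: (submoduleZ (MP i)).
move=> i j; elim: j i => [|j IH] i jil; have il : (i < l)%N by lia.
all: apply: (reduce _ _ il) => y Ey My [v Ev Mv].
  exists 0; first exact: (submodule0 (EP _)).
  rewrite linear0 subr0; apply: Mreg => //.
  by rewrite (E0 Ev) linear0 subr0 in Mv.
have Mdv : M i.+1 (d v).
  have -> : d v = f i *: y - (f i *: y - d v) by rewrite subKr.
  by apply: (submoduleB (MP _)); [exact: MS|exact: Mle].
have [v' Ev' Mv'] := IH i.+1 ltac:(lia) v Ev Mdv.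
have [|w Ew Mw] := @Msplit _ j.+1 _ Mv'; first by apply: (submoduleB (EP _)) => //; exact: Ed.
exists w => //; apply: Mreg => //.
have -> : f i *: (y - d w) = (f i *: y - d v) + d (v - d v' - f i *: w).
  by rewrite d_correction scalerBr addrA subrK.
by apply: (submoduleD (MP i)) => //; apply: Md.
Qed.

(** The image of the class of [z] under the composite of the connecting maps from
    H(C/M_i) to H(C/M_(i-1)), ..., to H(C/M_0) is the class of [y]. This is a
    relation between cochains because a quotient of d z by f_i is determined only
    modulo M_i. *)
Fixpoint connected (i j : nat) (z y : C) : Prop :=
  if i is i'.+1 then
    exists w, [/\ E j.+1 w, M i' (d z - f i' *: w) & connected i' j.+1 w y]
  else z = y.

Lemma connected_comb i j a z y z' y' :
  connected i j z y -> connected i j z' y' ->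
  connected i j (a *: z + z') (a *: y + y').
Proof.
elim: i j z z' => [|i IH] j z z' /=; first by move=> -> ->.
move=> [w [Ew Mw cw]] [w' [Ew' Mw' cw']]; exists (a *: w + w'); split.
- exact: (EP _).2.
- rewrite linearP scalerDr.
  have -> : a *: d z + d z' - (f i *: (a *: w) + f i *: w') =
      a *: (d z - f i *: w) + (d z' - f i *: w').
    by rewrite scalerBr !scalerA (mulrC a) opprD addrACA.
  exact: (MP _).2.
- exact: IH.
Qed.

Lemma connected0 i j :
  connected i j 0 0.
Proof.
elim: i j => [|i IH] j //=; exists 0; split=> //; first exact: (submodule0 (EP _)).
by rewrite linear0 scaler0 subr0; apply: (submodule0 (MP _)).
Qed.

Lemma connected_scale i j a z y :
  connected i j z y -> connected i j (a *: z) (a *: y).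
Proof.
by move/(connected_comb a)/(_ (connected0 i j)); rewrite !addr0.
Qed.

Lemma connected_add i j z y z' y' :
  connected i j z y -> connected i j z' y' -> connected i j (z + z') (y + y').
Proof. by move=> c c'; have := connected_comb 1 c c'; rewrite !scale1r. Qed.

(** The composite of the connecting maps is well defined on classes. Applied to a
    multiple of [z], it also shows that whatever kills the class of [z] kills that
    of [y]. *)
Lemma connected_coboundary i j N z y : (j + i)%N = N -> (i <= l)%N ->
  E j.+1 z -> connected i j.+1 z y -> coboundary_mod i j z -> coboundary_mod 0 N y.
Proof.
elim: i j z => [|i IH] j z jiN il Ez /=.
  by move=> <-; rewrite -jiN addn0.
move=> [w [Ew Mw cw]] [b Eb Mb].
have [|u Eu Mu] := @Msplit _ j.+1 _ Mb; first by apply: (submoduleB (EP _)) => //; exact: Ed.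
apply: (IH _ _ _ (ltnW il) Ew cw); first by rewrite addSnnS.
exists u => //; apply: Mreg => //.
have -> : f i *: (w - d u) = d (z - d b - f i *: u) - (d z - f i *: w).
  by rewrite d_correction scalerBr opprB [RHS]addrC addrA subrK.
by apply: (submoduleB (MP i)) => //; apply: Md.
Qed.

(** The kernel of each connecting map is the image of a cohomology group that
    vanishes by [acyclic_mod_regular]. *)
Lemma connected_injective i j N z y :
  (forall j', (j' < N)%N -> acyclic_mod 0 j') -> (j + i)%N = N -> (i <= l)%N ->
  E j.+1 z -> connected i j.+1 z y -> coboundary_mod 0 N y -> coboundary_mod i j z.
Proof.
move=> ac0; elim: i j z => [|i IH] j z jiN il Ez /=.
  by move=> ->; rewrite -jiN addn0.
move=> [w [Ew Mw cw]] By.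
have [|b Eb Mb] := IH _ w _ (ltnW il) Ew cw By; first by rewrite addSnnS.
apply: (@coboundary_mod_next _ _ _ b); apply: (coboundary_mod_lift _ _ _ Mw Mb) => //.
by apply: (acyclic_mod_regular ac0); lia.
Qed.

(** Every cocycle has an image; [G] is a grading of the complex for which f_i has
    degree [e i], so that division by f_i lowers the degree by [e i]. *)
Lemma connected_exists (G : int -> C -> Prop) (e : nat -> nat) :
  (forall t z, G t z -> G t (d z)) ->
  (forall i j t z, (i < l)%N -> M i.+1 z -> E j z -> G t z ->
    exists w, [/\ E j w, G (t - (e i)%:Z) w & M i (z - f i *: w)]) ->
  forall i j t z, (i <= l)%N -> E j z -> G t z -> M i (d z) ->
  exists y, [/\ connected i j z y, E (j + i)%N y & G (t - (\sum_(h < i) e h)%N%:Z) y].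
Proof.
move=> Gd Gsplit; elim=> [|i IH] j t z il Ez Gz Mz.
  by exists z; rewrite big_ord0 subr0 addn0.
have [w [Ew Gw Mw]] := Gsplit _ _ _ _ il Mz (Ed Ez) (Gd _ _ Gz).
have Mdw := quotient_cocycle il Mw.
have [y [cy Ey Gy]] := IH _ _ _ (ltnW il) Ew Gw Mdw.
exists y; split; [by exists w|by rewrite addnS -addSn|].
by rewrite big_ord_recr /= addnC PoszD opprD addrA.
Qed.

(** If d z = f_i w modulo M_i, then applying [phi] gives
    d (phi z) = f_i^p phi w = f_i (f_i^(p-1) phi w), so each connecting map
    contributes a factor f_i^(p-1). *)
Lemma connected_frobenius (phi : C -> C) (p : nat) :
  (0 < p)%N ->
  {morph phi : u v / u - v} -> (forall a u, phi (a *: u) = a ^+ p *: phi u) ->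
  (forall u, d (phi u) = phi (d u)) ->
  (forall j u, E j u -> E j (phi u)) -> (forall i u, M i u -> M i (phi u)) ->
  forall i j z y, connected i j z y ->
  connected i j (phi z) ((\prod_(h < i) f h) ^+ p.-1 *: phi y).
Proof.
move=> p0 phiB cochain_frobeniusZ phid phiE phiM; elim=> [|i IH] j z y /=.
  by move=> ->; rewrite big_ord0 expr1n scale1r.
move=> [w [Ew Mw cw]]; exists (f i ^+ p.-1 *: phi w); split.
- exact/(submoduleZ (EP _))/phiE.
- rewrite scalerA -exprS prednK // phid -cochain_frobeniusZ -phiB; exact: phiM.
- rewrite big_ord_recr /= mulrC exprMn -scalerA; apply: connected_scale; exact: IH.
Qed.

(** A class of H^N(C) killed by all the f_h lifts back along the connecting maps:
    being killed by f_i, it is the image of a class of H^(N-i-1)(C/M_(i+1)), again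
    nonzero and, by vanishing, again killed by the f_h. After N steps it sits in
    degree 0, where there are no coboundaries, and a further regular element
    cannot kill it. *)
Lemma regular_length_le N y :
  (forall j, (j < N)%N -> acyclic_mod 0 j) -> E N.+1 y ->
  ~ coboundary_mod 0 N y -> (forall h, (h < l)%N -> coboundary_mod 0 N (f h *: y)) ->
  (l <= N)%N.
Proof.
move=> ac0 Ey ny fy; case: leqP => // Nl.
have: exists z, [/\ E 1 z, ~ coboundary_mod N 0 z &
    forall h, (h < l)%N -> coboundary_mod N 0 (f h *: z)].
  have: (N <= N)%N by [].
  suff G i : (i <= N)%N -> exists z, [/\ E (N - i).+1 z, ~ coboundary_mod i (N - i) z &
      forall h, (h < l)%N -> coboundary_mod i (N - i) (f h *: z)].
    by move/G; rewrite subnn.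
  elim: i => [|i IH] iN; first by exists y; rewrite subn0.
  have [z [Ez nz fz]] := IH (ltnW iN).
  have il := ltn_trans iN Nl.
  have eN : (N - i = (N - i.+1).+1)%N by rewrite subnSK.
  rewrite eN in Ez nz fz.
  (* d v = f_i z, so z is the image of v under the connecting map. *)
  have [v Ev Mv] := fz i il.
  have fv h : (h < l)%N -> coboundary_mod i.+1 (N - i.+1) (f h *: v).
    move=> hl; have [u Eu Mu] := fz h hl.
    apply: (@coboundary_mod_next _ _ _ u).
    apply: (@coboundary_mod_lift _ _ (f h *: z)) => //.
    - by apply: (acyclic_mod_regular ac0); lia.
    - exact: (submoduleZ (EP _)).
    - rewrite linearZ /=.
      have -> : f h *: d v - f i *: (f h *: z) = - f h *: (f i *: z - d v).
        by rewrite scalerBr !scaleNr opprK !scalerA (mulrC (f i)) addrC.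
      exact: (submoduleZ (MP _)).
  exists v; split=> // -[b Eb Mb]; apply: nz.
  have [|u Eu Mu] := @Msplit _ (N - i.+1).+1 _ Mb.
    by apply: (submoduleB (EP _)) => //; exact: Ed.
  exists u => //; apply: Mreg => //.
  have -> : f i *: (z - d u) = (f i *: z - d v) + d (v - d b - f i *: u).
    by rewrite d_correction scalerBr addrA subrK.
  by apply: (submoduleD (MP i)) => //; apply: Md.
move=> [z [Ez nz fz]]; exfalso; apply: nz; have [b Eb Mb] := fz N Nl.
by exists b => //; move: Mb; rewrite (E0 Eb) linear0 !subr0; exact: Mreg.
Qed.

End Complex.

(** * Ideals in localizations and Cech cochains *)

Lemma dependent_choice (I : Type) (T : I -> Type) (P : forall i, T i -> Prop) :
  (forall i, exists t, P i t) -> exists w : forall i, T i, forall i, P i (w i).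
Proof. by move=> Pex; exists (fun i => projT1 (cid (Pex i))) => i; case: cid. Qed.

Section IdealTheory.
Variable S : comNzRingType.
Implicit Types J : ideal S.

Lemma ideal0 J : J 0. Proof. by have [] := idealP J. Qed.
Lemma idealD J a b : J a -> J b -> J (a + b).
Proof. by have [_ D _] := idealP J; apply: D. Qed.
Lemma ideal_mull J a b : J b -> J (a * b).
Proof. by have [_ _ M] := idealP J; apply: M. Qed.
Lemma ideal_mulr J a b : J a -> J (a * b).
Proof. by rewrite mulrC; apply: ideal_mull. Qed.
Lemma idealN J a : J a -> J (- a).
Proof. by rewrite -mulN1r; apply: ideal_mull. Qed.
Lemma ideal_sum J T (r : seq T) (P : pred T) (F : T -> S) :
  (forall i, P i -> J (F i)) -> J (\sum_(i <- r | P i) F i).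
Proof. by move=> JF; elim/big_ind: _ => //; [exact: ideal0|exact: idealD]. Qed.
Lemma mem_span (X : set S) a : X a -> Defs.span X a.
Proof.
move=> Xa; exists 1%N, (fun=> 1), (fun=> a); split=> //.
by rewrite big_ord1 mul1r.
Qed.

Lemma span_le (X : set S) J : (forall a, X a -> J a) -> ideal_le (Defs.span X) J.
Proof.
move=> XJ a [N [g [x [Xx ->]]]]; apply: ideal_sum => i _.
exact/ideal_mull/XJ.
Qed.

Variable f : nat -> S.

Definition initial_ideal (i : nat) : ideal S :=
  Defs.span [set f j | j in [set j : nat | (j < i)%N]].

Lemma mem_initial i j : (j < i)%N -> initial_ideal i (f j).
Proof. by move=> ji; apply: mem_span; exists j. Qed.

Lemma initial_le i j : (i <= j)%N -> ideal_le (initial_ideal i) (initial_ideal j).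
Proof.
move=> ij; apply: span_le => _ [h /= hi <-]; apply: mem_initial.
exact: leq_trans ij.
Qed.

Lemma initial0 a : initial_ideal 0 a -> a = 0.
Proof.
by move=> [N [g [x [Xx ->]]]]; rewrite big1 // => i _; case: (Xx i).
Qed.

Lemma initialS i a : initial_ideal i.+1 a -> exists h, initial_ideal i (a - h * f i).
Proof.
move=> [N [g [x [Xx ->]]]].
elim/big_ind: _ => [|u v [h hu] [k kv]|j _].
- by exists 0; rewrite mul0r subr0; apply: ideal0.
- by exists (h + k); rewrite mulrDl opprD addrACA; apply: idealD.
- have [h hi <-] := Xx j; have: (h <= i)%N := hi.
  rewrite leq_eqVlt => /orP[/eqP ->|{}hi].
    by exists (g j); rewrite subrr; apply: ideal0.
  by exists 0; rewrite mul0r subr0; apply/ideal_mull/mem_initial.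
Qed.

End IdealTheory.

Section LocalizedIdeal.
Variables (S : comNzRingType) (y : S).
Implicit Types (J : ideal S) (u v : loc y).

Definition loc_scale (s : S) (u : loc y) : loc y := loc_frac y s 0 * u.

Lemma loc_scaleE s a k : loc_scale s (loc_frac y a k) = loc_frac y (s * a) k.
Proof. by rewrite /loc_scale loc_fracM. Qed.

Lemma loc_scaleA a b u : loc_scale a (loc_scale b u) = loc_scale (a * b) u.
Proof. by rewrite /loc_scale mulrA loc_fracM. Qed.

Lemma loc_scale1 u : loc_scale 1 u = u.
Proof. by have [a [k ->]] := loc_fracE u; rewrite loc_scaleE mul1r. Qed.

Lemma loc_scaleDr a u v : loc_scale a (u + v) = loc_scale a u + loc_scale a v.
Proof. exact: mulrDr. Qed.

Lemma loc_scaleDl a b u : loc_scale (a + b) u = loc_scale a u + loc_scale b u.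
Proof. by rewrite /loc_scale -mulrDl loc_fracD !expr0 !mul1r. Qed.

Lemma loc_frac_shift a k e : loc_frac y a k = loc_frac y (y ^+ e * a) (e + k).
Proof. by apply/loc_fracP; exists 0%N; rewrite exprD; ring. Qed.

Lemma loc_frac_addl a b k : loc_frac y (a + b) k = loc_frac y a k + loc_frac y b k.
Proof. by rewrite loc_fracD; apply/loc_fracP; exists 0%N; rewrite exprD; ring. Qed.

Definition loc_ideal J u : Prop := exists a k, J a /\ u = loc_frac y a k.

Lemma loc_idealE J a k :
  loc_ideal J (loc_frac y a k) <-> exists e, J (y ^+ e * a).
Proof.
split=> [[b [l [Jb /loc_fracP[e eab]]]]|[e Ja]]; last first.
  by exists (y ^+ e * a), (e + k)%N; split=> //; apply: loc_frac_shift.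
exists (e + l)%N; rewrite exprD -mulrA eab; exact/ideal_mull/ideal_mull.
Qed.

Lemma loc_ideal0 J : loc_ideal J 0.
Proof. by exists 0, 0%N; split; rewrite ?loc_frac0 //; apply: ideal0. Qed.

Lemma loc_idealD J u v : loc_ideal J u -> loc_ideal J v -> loc_ideal J (u + v).
Proof.
move=> [a [k [Ja ->]]] [b [l [Jb ->]]]; rewrite loc_fracD.
by exists (y ^+ l * a + y ^+ k * b), (k + l)%N; split=> //; apply: idealD; apply: ideal_mull.
Qed.

Lemma loc_idealM J u v : loc_ideal J v -> loc_ideal J (u * v).
Proof.
move=> [b [l [Jb ->]]]; have [a [k ->]] := loc_fracE u; rewrite loc_fracM.
by exists (a * b), (k + l)%N; split=> //; apply: ideal_mull.
Qed.

Lemma loc_idealX J u n : (0 < n)%N -> loc_ideal J u -> loc_ideal J (u ^+ n).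
Proof. by case: n => // n _ Ju; rewrite exprS mulrC; apply: loc_idealM. Qed.

Lemma loc_ideal_sum J T (r : seq T) (P : pred T) (F : T -> loc y) :
  (forall i, P i -> loc_ideal J (F i)) -> loc_ideal J (\sum_(i <- r | P i) F i).
Proof. by move=> JF; elim/big_ind: _ => //; [exact: loc_ideal0|exact: loc_idealD]. Qed.

Lemma loc_ideal_le J J' u : ideal_le J J' -> loc_ideal J u -> loc_ideal J' u.
Proof. by move=> JJ' [a [k [/JJ' Ja ->]]]; exists a, k. Qed.

Lemma loc_ideal_cancel J a u :
  (forall b, J (a * b) -> J b) -> loc_ideal J (loc_scale a u) -> loc_ideal J u.
Proof.
move=> Ja; have [b [k ->]] := loc_fracE u; rewrite loc_scaleE.
by move=> /loc_idealE[e]; rewrite mulrCA => /Ja ?; apply/loc_idealE; exists e.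
Qed.

Lemma loc_ideal_initial0 f u : loc_ideal (initial_ideal f 0) u -> u = 0.
Proof. by move=> [a [k [/initial0 -> ->]]]; apply: loc_frac0. Qed.

Lemma loc_ideal_initialS f i u : loc_ideal (initial_ideal f i.+1) u ->
  exists w, loc_ideal (initial_ideal f i) (u - loc_scale (f i) w).
Proof.
move=> [a [k [/initialS[h hJ] ->]]]; exists (loc_frac y h k).
rewrite loc_scaleE loc_fracN -loc_frac_addl mulrC.
by exists (a - h * f i), k.
Qed.

End LocalizedIdeal.

Section LocalizedIdealMap.
Variables (S : comNzRingType) (y y' z : S).
Hypothesis eyz : y' = y * z.
Implicit Types (J : ideal S) (u v : loc y).

Lemma loc_map_scale a u :
  loc_map y' z (loc_scale a u) = loc_scale a (loc_map y' z u).
Proof.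
have [b [k ->]] := loc_fracE u.
by rewrite loc_scaleE !loc_mapE // loc_scaleE mulrA.
Qed.

Lemma loc_ideal_map J u : loc_ideal J u -> loc_ideal J (loc_map y' z u).
Proof.
move=> [a [k [Ja ->]]]; rewrite loc_mapE //; exists (a * z ^+ k), k; split=> //.
exact: ideal_mulr.
Qed.

(** The kernel, also modulo J, and the cokernel of S_y -> S_(yz) are z-power
    torsion. Both this lemma and the next allow every large exponent, so that one
    exponent serves all the finitely many components of a cochain. *)
Lemma loc_ideal_map_torsion J u : loc_ideal J (loc_map y' z u) ->
  exists e0, forall e, (e0 <= e)%N -> loc_ideal J (loc_scale (z ^+ e) u).
Proof.
have [a [k ->]] := loc_fracE u; rewrite loc_mapE // => /loc_idealE[M JM].
exists (M + k)%N => e le_e; rewrite loc_scaleE; apply/loc_idealE; exists M.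
rewrite -(subnK le_e) !exprD -!mulrA mulrCA; apply: ideal_mull.
by move: JM; rewrite eyz exprMn; congr (J _); ring.
Qed.

Lemma loc_map_divide (u : loc y') : exists e0, forall e, (e0 <= e)%N ->
  exists w : loc y, loc_map y' z w = loc_scale (z ^+ e) u.
Proof.
have [a [k ->]] := loc_fracE u; exists k => e le_e.
exists (loc_frac y (z ^+ (e - k) * a) k); rewrite loc_mapE // loc_scaleE.
by rewrite -{2}(subnK le_e) exprD; congr (loc_frac _ _ _); ring.
Qed.

End LocalizedIdealMap.

Section CochainModule.
Variables (S : comNzRingType) (m : nat) (x : 'I_m -> S).
Local Notation cochain := (cochain x).

Definition cochain_scale (s : S) (c : cochain) : cochain :=
  fun I => loc_scale s (c I).

Lemma cochain_scaleA a b c :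
  cochain_scale a (cochain_scale b c) = cochain_scale (a * b) c.
Proof. by apply: functional_extensionality_dep => I; apply: loc_scaleA. Qed.

Lemma cochain_scale1 c : cochain_scale 1 c = c.
Proof. by apply: functional_extensionality_dep => I; apply: loc_scale1. Qed.

Lemma cochain_scaleDr a : {morph cochain_scale a : u v / u + v}.
Proof. by move=> u v; apply: functional_extensionality_dep => I; apply: loc_scaleDr. Qed.

Lemma cochain_scaleDl c : {morph cochain_scale^~ c : a b / a + b}.
Proof. by move=> a b; apply: functional_extensionality_dep => I; apply: loc_scaleDl. Qed.

HB.instance Definition _ := GRing.Zmodule_isLmodule.Build S cochain
  cochain_scaleA cochain_scale1 cochain_scaleDr cochain_scaleDl.

Lemma cochainD (u v : cochain) I : (u + v) I = u I + v I. Proof. by []. Qed.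
Lemma cochainB (u v : cochain) I : (u - v) I = u I - v I. Proof. by []. Qed.
Lemma cochainZ a (u : cochain) I : (a *: u) I = loc_scale a (u I). Proof. by []. Qed.

Lemma cech_d_is_scalable : scalable (@cech_d S m x).
Proof.
move=> a c; apply: functional_extensionality_dep => I.
rewrite [RHS]cochainZ /loc_scale mulr_sumr; apply: eq_bigr => j jI.
by rewrite cochainZ (loc_map_scale (cech_prodD1 x jI)) mulrCA.
Qed.

HB.instance Definition _ := GRing.isScalable.Build S cochain cochain _
  (@cech_d S m x) cech_d_is_scalable.

(** Cochains of degree [j] - 1, so that the piece [j] = 0 is zero. *)
Definition cochain_degree_pred (j : nat) (c : cochain) : Prop :=
  forall I : {set 'I_m}, #|I|.+1 != j -> c I = 0.

Definition cochain_mod (J : ideal S) (c : cochain) : Prop :=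
  forall I, loc_ideal J (c I).

Lemma cochain_degree_pred_submodule j : submodule (cochain_degree_pred j).
Proof.
split=> [//|a u v Eu Ev I Ij].
by rewrite cochainD cochainZ Eu // Ev // addr0 /loc_scale mulr0.
Qed.

Lemma cochain_mod_submodule J : submodule (cochain_mod J).
Proof.
split=> [I|a u v Mu Mv I]; first exact: loc_ideal0.
by rewrite cochainD cochainZ; apply: loc_idealD => //; apply: loc_idealM.
Qed.

Lemma cochain_degree_pred_d j c : cochain_degree_pred j c -> cochain_degree_pred j.+1 (cech_d c).
Proof.
move=> Ec I Ij; rewrite /cech_d big1 // => i iI.
have eI := cardsD1 i I; rewrite iI in eI.
rewrite Ec; last by lia.
by rewrite -(loc_frac0 _ 0) (loc_mapE (cech_prodD1 x iI)) mul0r loc_frac0 mulr0.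
Qed.

Lemma cochain_mod_d J c : cochain_mod J c -> cochain_mod J (cech_d c).
Proof.
move=> Mc I; apply: loc_ideal_sum => j jI; apply: loc_idealM.
by apply: (loc_ideal_map (cech_prodD1 x jI)).
Qed.

Definition partial_regular (f : nat -> S) (l : nat) : Prop :=
  forall i a, (i < l)%N -> initial_ideal f i (f i * a) -> initial_ideal f i a.

(** Localization is flat: f_i u lies in J_i S_y for u = a / y^k only if y^e f_i a
    lies in J_i for some e, hence y^e a does. *)
Lemma cech_complex_mod (f : nat -> S) l : partial_regular f l ->
  complex_mod_sequence (@cech_d S m x) cochain_degree_pred f l
    (fun i => cochain_mod (initial_ideal f i)).
Proof.
move=> reg; split.
- exact: cech_d2.
- exact: cochain_degree_pred_submodule.
- by move=> z Ez; apply: functional_extensionality_dep => I; apply: Ez.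
- exact: cochain_degree_pred_d.
- by move=> i; apply: cochain_mod_submodule.
- by move=> i; apply: cochain_mod_d.
- move=> i z I; rewrite cochainZ; have [a [k ->]] := loc_fracE (z I).
  rewrite loc_scaleE; exists (f i * a), k; split=> //.
  exact/ideal_mulr/mem_initial.
- by move=> i z Mz I; apply: loc_ideal_le (Mz I); apply: initial_le.
- move=> i j z Mz Ez.
  have /dependent_choice[w wP] : forall I, exists w : loc (cech_prod x I),
      (#|I|.+1 != j -> w = 0) /\
      loc_ideal (initial_ideal f i) (z I - loc_scale (f i) w).
    move=> I; case: (eqVneq #|I|.+1 j) => [_|/Ez ->].
      by have [w Mw] := loc_ideal_initialS (Mz I); exists w.
    by exists 0; split=> //; rewrite /loc_scale mulr0 subr0; apply: loc_ideal0.
  exists w; first by move=> I; have [] := wP I.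
  by move=> I; have [] := wP I.
- move=> i z il Mz I; have := Mz I; rewrite cochainZ.
  by apply: loc_ideal_cancel => b; apply: reg.
Qed.

End CochainModule.

(** * Vanishing of Cech cohomology below the top degree *)

Lemma uniform_exponent (T : finType) (P : T -> nat -> Prop) :
  (forall t, exists e0, forall e, (e0 <= e)%N -> P t e) -> exists e, forall t, P t e.
Proof.
move=> /choice[e0 Pe0]; exists (\max_t e0 t) => t; apply: Pe0.
exact: leq_bigmax.
Qed.

Lemma loc_map0 (A : comPzRingType) (x y z : A) :
  y = x * z -> loc_map y z (0 : loc x) = 0.
Proof. by move=> e; rewrite -(loc_frac0 x 0) (loc_mapE e) mul0r loc_frac0. Qed.

Lemma loc_map_sign (A : comPzRingType) (x y z : A) s (u : loc x) :
  y = x * z -> loc_map y z ((-1) ^+ s * u) = (-1) ^+ s * loc_map y z u.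
Proof.
move=> e; elim: s => [|s IH]; first by rewrite !mul1r.
by rewrite !exprS -!mulrA !mulN1r (loc_mapN e) IH.
Qed.

Section Torsion.
Variables (S : comNzRingType) (m : nat) (x : 'I_m -> S) (v : 'I_m).
Implicit Types (z w : cochain x) (J : ideal S).

Lemma cech_d_at z (K : {set 'I_m}) : v \in K ->
  (forall I : {set 'I_m}, v \in I -> #|I|.+1 = #|K| -> z I = 0) ->
  cech_d z K =
    (-1) ^+ cech_sign K v * loc_map (cech_prod x K) (x v) (z (K :\ v)).
Proof.
move=> vK z0; rewrite /cech_d (bigD1 v) //= big1 ?addr0 // => i /andP[iK iv].
rewrite z0 ?(loc_map0 (cech_prodD1 x iK)) ?mulr0 //.
  by rewrite !inE eq_sym iv.
by rewrite (cardsD1 i K) iK.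
Qed.

(** The contraction of the Cech complex after inverting x_v, which sends [z] to
    I |-> +- z (v, I), times a power of x_v that clears the new denominators. Its
    coboundary is computed on the sets containing v only; d d = 0 takes care of
    the others in [cech_torsion]. *)
Lemma cech_contraction j z : cochain_degree_pred j.+1 z ->
  exists e w, [/\ cochain_degree_pred j w, forall I : {set 'I_m}, v \in I -> w I = 0 &
    forall I : {set 'I_m}, v \in I -> cech_d w I = (x v ^+ e *: z) I].
Proof.
move=> Ez; pose sgn I (u : loc (cech_prod x I)) := (-1) ^+ cech_sign I v * u.
have [|e div] := uniform_exponent (T := {set 'I_m}) (P := fun I e => v \in I ->
    exists w : loc (cech_prod x (I :\ v)),
      sgn I (loc_map (cech_prod x I) (x v) w) = loc_scale (x v ^+ e) (z I)).
  move=> I; have [vI|] := boolP (v \in I); last by exists 0%N => e _.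
  have eI := cech_prodD1 x vI.
  have [e0 div] := loc_map_divide eI (z I); exists e0 => e /div[w wP] _.
  exists ((-1) ^+ cech_sign I v * w).
  by rewrite /sgn (loc_map_sign _ _ eI) mulrA -expr2 sqrr_sign mul1r.
have /dependent_choice[w wP] : forall I0, exists w : loc (cech_prod x I0),
    [/\ #|I0|.+1 != j -> w = 0, v \in I0 -> w = 0 &
      forall I : {set 'I_m}, v \in I -> I :\ v = I0 ->
        sgn I (loc_map (cech_prod x I) (x v) w) = loc_scale (x v ^+ e) (z I)].
  move=> I0; have [vI0|vI0] := boolP (v \in I0).
    by exists 0; split=> // I vI eI; move: vI0; rewrite -eI !inE eqxx.
  have [I0j|I0j] := eqVneq #|I0|.+1 j; last first.
    exists 0; split=> // I vI eI.
    rewrite (loc_map0 (y := cech_prod x I)); last first.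
      by rewrite -eI; apply: cech_prodD1.
    rewrite Ez; first by rewrite /sgn /loc_scale !mulr0.
    by rewrite (cardsD1 v I) vI eI.
  have := div (v |: I0) (setU11 _ _); rewrite setU1K // => -[w wP].
  exists w; split=> // I vI eI.
  have -> : I = v |: I0 by rewrite -eI finset.setD1K.
  exact: wP.
exists e, w; split=> [I Ij|I vI|I vI]; try by have [-> //] := wP I.
  by have [_ -> //] := wP I.
rewrite cech_d_at //; first by have [_ _ /(_ I vI erefl)] := wP (I :\ v).
by move=> I' vI' _; have [_ -> //] := wP I'.
Qed.

(** The cochain y = x_v^e z - d w vanishes on the sets containing v, so at such a
    set K the coboundary d y has the single term +- y (K \ v). As d y is zero
    modulo J, a power of x_v kills y modulo J. *)
Lemma cech_torsion J j z : cochain_degree_pred j.+1 z -> cochain_mod J (cech_d z) ->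
  exists e b, cochain_degree_pred j b /\ cochain_mod J (x v ^+ e *: z - cech_d b).
Proof.
move=> Ez Mdz; have [e [w [Ew w0 dw]]] := cech_contraction Ez.
pose y := x v ^+ e *: z - cech_d w.
have y0 (I : {set 'I_m}) : v \in I -> y I = 0 by move=> vI; rewrite /y cochainB dw // subrr.
have Mdy : cochain_mod J (cech_d y).
  rewrite /y raddfB /= cech_d2 subr0 linearZ.
  exact: (submoduleZ (cochain_mod_submodule _ _)).
have [|e' kill] := uniform_exponent (T := {set 'I_m}) (P := fun K e1 => v \in K ->
    loc_ideal J (loc_scale (x v ^+ e1) (y (K :\ v)))).
  move=> K; have [vK|] := boolP (v \in K); last by exists 0%N => e1 _.
  have eK := cech_prodD1 x vK.
  have /(loc_ideal_map_torsion eK)[e0 kill] :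
      loc_ideal J (loc_map (cech_prod x K) (x v) (y (K :\ v))).
    have := Mdy K; rewrite (cech_d_at vK (fun I vI _ => y0 I vI)).
    move=> /(loc_idealM ((-1) ^+ cech_sign K v)).
    by rewrite mulrA -expr2 sqrr_sign mul1r.
  by exists e0 => e1 /kill.
exists (e' + e)%N, (x v ^+ e' *: w); split.
  exact: (submoduleZ (cochain_degree_pred_submodule _ _)).
have -> : x v ^+ (e' + e) *: z - cech_d (x v ^+ e' *: w) = x v ^+ e' *: y.
  by rewrite scalerBr scalerA -exprD [cech_d _]linearZ.
move=> I; rewrite cochainZ; have [vI|vI] := boolP (v \in I).
  by rewrite y0 // /loc_scale mulr0; apply: loc_ideal0.
suff G (K I0 : {set 'I_m}) : v \in K -> K :\ v = I0 ->
    loc_ideal J (loc_scale (x v ^+ e') (y I0)).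
  by apply: (G (v |: I)); rewrite ?setU11 ?setU1K.
by move=> vK <-; apply: kill.
Qed.

End Torsion.

Section Extend.
Variable (S : comNzRingType) (c : nat) (f : 'I_c -> S).

(** Padding by 0 lets the initial segments be indexed by [nat]. *)
Definition extend_seq (i : nat) : S := oapp f 0 (insub i).

Lemma extend_seqE (i : 'I_c) : extend_seq i = f i.
Proof. by rewrite /extend_seq valK. Qed.

Lemma span_family_extend a : span_family f a <-> initial_ideal extend_seq c a.
Proof.
split; apply: span_le => b.
  by move=> [i _ <-]; rewrite -extend_seqE; apply: mem_initial.
move=> [i hi <-]; apply: mem_span.
by exists (Ordinal (hi : (i < c)%N)); rewrite // -extend_seqE.
Qed.

Lemma regular_sequence_partial : regular_sequence f -> partial_regular extend_seq c.
Proof.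
have spanE i a : (i <= c)%N ->
    Defs.span [set f j | j in [set j : 'I_c | (j < i)%N]] a <-> initial_ideal extend_seq i a.
  move=> ic; split; apply: span_le => b.
    by move=> [j /= ji <-]; rewrite -extend_seqE; apply: mem_initial.
  move=> [j /= ji <-]; apply: mem_span.
  by exists (Ordinal (leq_trans ji ic)); rewrite // -extend_seqE.
move=> [_ reg] i a ic; rewrite -(spanE i _ (ltnW ic)) -(spanE i _ (ltnW ic)).
by rewrite -[i]/(nat_of_ord (Ordinal ic)) extend_seqE; apply: reg.
Qed.

Lemma prod_extend : \prod_(i < c) extend_seq i = \prod_(i < c) f i.
Proof. by apply: eq_bigr => i _; rewrite extend_seqE. Qed.

End Extend.

(** Each x_v acts as torsion on cohomology, and the x_v form a regular sequence,
    so [acyclic_mod_torsion] applies with f = x. *)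
Lemma cech_acyclic (S : comNzRingType) (m : nat) (x : 'I_m -> S) (f : nat -> S) j :
  partial_regular (extend_seq x) m -> (j < m)%N ->
  acyclic_mod (@cech_d S m x) (@cochain_degree_pred S m x)
    (fun i => cochain_mod (initial_ideal f i)) 0 j.
Proof.
move=> reg jm z Ez Mz.
(* Both sequences start from the zero ideal. *)
have zero (c : cochain x) h h' :
    cochain_mod (initial_ideal h 0) c -> cochain_mod (initial_ideal h' 0) c.
  by move=> Mc I; apply: loc_ideal_le (Mc I) => a /initial0 ->; apply: ideal0.
have cplx := cech_complex_mod x reg.
have tors i j' z' : (i < m)%N -> cochain_degree_pred j'.+1 z' ->
    cochain_mod (initial_ideal (extend_seq x) i) (cech_d z') ->
    exists e, coboundary_mod (@cech_d S m x) (@cochain_degree_pred S m x)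
      (fun i => cochain_mod (initial_ideal (extend_seq x) i)) i j'
      (extend_seq x i ^+ e *: z').
  move=> il Ez' Mz'.
  have [e [b [Eb Mb]]] := cech_torsion (Ordinal il) Ez' Mz'.
  exists e; exists b => //; move: Mb.
  by rewrite -(extend_seqE x (Ordinal il)).
have [|b Eb Mb] := acyclic_mod_torsion cplx tors _ Ez (zero _ _ _ Mz).
  by rewrite addn0.
by exists b => //; apply: zero Mb.
Qed.

(** * Lifting cochains from the quotient ring *)

Section QuotientMap.
Variables (S : comNzRingType) (J : ideal S).

Lemma quot_mapX a n : quot_map J (a ^+ n) = quot_map J a ^+ n.
Proof. by elim: n => [|n IH]; rewrite ?expr0 // !exprS quot_mapM IH. Qed.

Lemma quot_map_eq0 a : quot_map J a = 0 <-> J a.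
Proof. by rewrite -(quot_map0 J) quot_mapP subr0. Qed.

Definition loc_quot (y : S) (yb : quot_ring J) (u : loc y) : loc yb :=
  loc_frac yb (quot_map J (loc_repr u).1) (loc_repr u).2.

Section At.
Variables (y : S) (yb : quot_ring J).
Hypothesis ey : yb = quot_map J y.

Lemma loc_quotE a k :
  @loc_quot y yb (loc_frac y a k) = loc_frac yb (quot_map J a) k.
Proof.
have [N eN] := loc_repr_frac y a k; apply/loc_fracP; exists N.
by move/(congr1 (quot_map J)): eN; rewrite !quot_mapM !quot_mapX -ey.
Qed.

Lemma loc_quotB : {morph @loc_quot y yb : u v / u - v}.
Proof.
move=> u v; have [a [k ->]] := loc_fracE u; have [b [l ->]] := loc_fracE v.
rewrite loc_fracN loc_fracD !loc_quotE loc_fracN loc_fracD; congr loc_frac.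
have -> : - quot_map J b = quot_map J (- b).
  apply: (addIr (quot_map J b)); rewrite addNr -quot_mapD addNr.
  by rewrite quot_map0.
by rewrite quot_mapD !quot_mapM !quot_mapX -ey.
Qed.

Lemma loc_quot0 : @loc_quot y yb 0 = 0.
Proof. by rewrite -(loc_frac0 y 0) loc_quotE quot_map0 loc_frac0. Qed.

Lemma loc_quotM : {morph @loc_quot y yb : u v / u * v}.
Proof.
move=> u v; have [a [k ->]] := loc_fracE u; have [b [l ->]] := loc_fracE v.
by rewrite loc_fracM !loc_quotE loc_fracM quot_mapM.
Qed.

Lemma loc_quotX u n : @loc_quot y yb (u ^+ n) = @loc_quot y yb u ^+ n.
Proof.
have [a [k ->]] := loc_fracE u.
by rewrite loc_fracX !loc_quotE loc_fracX quot_mapX.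
Qed.

Lemma loc_quot_eq0 u : @loc_quot y yb u = 0 <-> loc_ideal J u.
Proof.
have [a [k ->]] := loc_fracE u; rewrite loc_quotE loc_idealE.
rewrite -(loc_frac0 yb 0) loc_fracP; split=> -[N eN]; exists N; last first.
  by move/quot_map_eq0: eN; rewrite quot_mapM quot_mapX -ey mul1r !mulr0.
apply/quot_map_eq0; rewrite quot_mapM quot_mapX -ey.
by move: eN; rewrite mul1r !mulr0.
Qed.

End At.

Lemma loc_quot_map (y y' z : S) (yb yb' zb : quot_ring J) (u : loc y) :
  y' = y * z -> yb = quot_map J y -> zb = quot_map J z -> yb' = quot_map J y' ->
  @loc_quot y' yb' (loc_map y' z u) = loc_map yb' zb (@loc_quot y yb u).
Proof.
move=> ey eb ez eb'; have eyb : yb' = yb * zb by rewrite eb' ey quot_mapM -eb -ez.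
have [a [k ->]] := loc_fracE u.
by rewrite loc_mapE // !loc_quotE // loc_mapE // quot_mapM quot_mapX -ez.
Qed.

End QuotientMap.

Section CochainQuotient.
Variables (k : fieldType) (n : nat) (J : ideal {mpoly k[n]}).
Local Notation S := {mpoly k[n]}.
Local Notation X := (fun i : 'I_n => 'X_i : S).
Local Notation Xb := (quot_var J).

Lemma cech_prod_quot I : cech_prod Xb I = quot_map J (cech_prod X I).
Proof.
rewrite /cech_prod (big_morph (quot_map J) (@quot_mapM _ J) (quot_map1 J)) //.
Qed.

Definition cochain_quot (c : cochain X) : cochain Xb :=
  fun I => loc_quot (cech_prod Xb I) (c I).

Lemma cochain_quot_d c : cochain_quot (cech_d c) = cech_d (cochain_quot c).
Proof.
apply: functional_extensionality_dep => I; have eI := cech_prod_quot I.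
rewrite /cochain_quot /cech_d.
have add : {morph @loc_quot _ J _ (cech_prod Xb I) :
    u v / (u : loc (cech_prod X I)) + v >-> u + v}.
  move=> u v; apply: (addIr (- loc_quot (cech_prod Xb I) v)).
  by rewrite -loc_quotB // !addrK.
rewrite (big_morph _ add (loc_quot0 eI)); apply: eq_bigr => j jI.
rewrite loc_quotM // (loc_quot_map _ (cech_prodD1 X jI)  (cech_prod_quot _) erefl eI).
congr (_ * _); rewrite loc_quotX //; congr (_ ^+ _).
have e1 : @loc_quot _ J _ (cech_prod Xb I) (1 : loc (cech_prod X I)) = 1.
  by rewrite -[1]/(loc_frac _ 1 0) loc_quotE.
apply: (addIr 1); rewrite addNr -{1}e1 -add addNr; exact: loc_quot0.
Qed.

Lemma cochain_quotB : {morph cochain_quot : u v / u - v}.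
Proof.
move=> u v; apply: functional_extensionality_dep => I.
exact: (loc_quotB (cech_prod_quot I)).
Qed.

Lemma cochain_quot_eq0 c : cochain_quot c = 0 <-> cochain_mod J c.
Proof.
split=> [c0 I|Mc]; last first.
  apply: functional_extensionality_dep => I.
  exact/(loc_quot_eq0 (cech_prod_quot I)).
apply/(loc_quot_eq0 (cech_prod_quot I)).
by rewrite -[LHS]/(cochain_quot c I) c0.
Qed.

Lemma cochain_quot_frobenius p (hp : p \in [pchar k]) c :
  cochain_quot (cochain_frobenius p c) = cochain_frobenius p (cochain_quot c).
Proof.
apply: functional_extensionality_dep => I.
exact: (loc_quotX (cech_prod_quot I)).
Qed.

Lemma cochain_quot_lift (cb : cochain Xb) (P : forall I, loc (cech_prod X I) -> Prop) :
  (forall I, exists2 u, P I u & loc_quot (cech_prod Xb I) u = cb I) ->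
  exists2 c, (forall I, P I (c I)) & cochain_quot c = cb.
Proof.
move=> lift; have /dependent_choice[c cP] : forall I, exists u,
    P I u /\ loc_quot (cech_prod Xb I) u = cb I.
  by move=> I; have [u] := lift I; exists u.
exists c; first by move=> I; have [] := cP I.
by apply: functional_extensionality_dep => I; have [_] := cP I.
Qed.

Lemma loc_quot_surjective I (ub : loc (cech_prod Xb I)) :
  exists u, @loc_quot _ J (cech_prod X I) _ u = ub.
Proof.
have [a [e ->]] := loc_fracE ub; exists (loc_frac _ (quot_repr a) e).
by rewrite loc_quotE ?quot_reprK //; apply: cech_prod_quot.
Qed.

(** Cochains over S/J are those over S modulo J, so a class over S/J can be tested
    for vanishing on a lift to S. *)
Lemma cohomology_class_eq0 j (cb : cocycle Xb j) c :
  cochain_quot c = cocycle_val cb ->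
  cohomology_class cb = 0 <->
  exists2 b, cochain_degree_pred j b & cochain_mod J (c - cech_d b).
Proof.
move=> cE.
have -> : (cohomology_class cb = 0) <-> cb \in @coboundary_pred _ _ Xb j.
  by rewrite -[X in _ = X](raddf0 (@cohomology_class _ _ Xb j)) cohomology_classP subr0.
split=> [/asboolP[bb [bb0 dbb]]|[b Eb Mb]]; last first.
  apply/asboolP; exists (cochain_quot b); split=> [I Ij|].
    by rewrite /cochain_quot Eb // (loc_quot0 (cech_prod_quot I)).
  rewrite -cE -cochain_quot_d; apply/eqP; rewrite -subr_eq0 -cochain_quotB.
  by apply/eqP/cochain_quot_eq0.
have [I|b Eb bE] := @cochain_quot_lift bb (fun I u => #|I|.+1 != j -> u = 0).
  case: (eqVneq #|I|.+1 j) => [_|Ij].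
    by have [u uE] := loc_quot_surjective (bb I); exists u.
  exists 0 => //; rewrite bb0 // loc_quot0 //; exact: cech_prod_quot.
exists b => //; apply/cochain_quot_eq0.
by rewrite cochain_quotB cochain_quot_d bE cE dbb subrr.
Qed.

End CochainQuotient.

(** * Gradings *)

Section HomogeneousComponents.
Variables (k : fieldType) (n : nat).
Local Notation S := {mpoly k[n]}.
Implicit Types (a b h f : S).

Lemma pihomogM_homog s d h f : f \is d.-homog ->
  pihomog [measure of mdeg] s (h * f) =
  (if (d <= s)%N then pihomog [measure of mdeg] (s - d) h else 0) * f.
Proof.
move=> hf; rewrite [h]mpolyE mulr_suml.
have XmE m : pihomog [measure of mdeg] s ('X_[m] * f) =
    if (mdeg m + d == s)%N then 'X_[m] * f else 0.
  have hX : 'X_[m] * f \is (mdeg m + d).-homog.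
    by apply: dhomogM => //; rewrite dhomogX.
  case: eqP => [<-|/eqP ne]; first exact: pihomog_dE.
  exact: pihomog_ne0 hX.
rewrite raddf_sum /=; case: leqP => ds.
  rewrite raddf_sum mulr_suml; apply: eq_bigr => m _ /=.
  rewrite -scalerAl !linearZ /= -scalerAl XmE pihomogX.
  have -> : (mdeg m + d == s)%N = (mdeg m == s - d)%N by apply/eqP/eqP; lia.
  by case: eqP; rewrite ?mul0r.
rewrite mul0r big1 // => m _; rewrite -scalerAl linearZ /= XmE.
by case: eqP => [|_]; [lia|rewrite scaler0].
Qed.

Variables (f : nat -> S) (deg : nat -> nat).
Hypothesis f_homog : forall i, f i \is (deg i).-homog.

Lemma initial_pihomog i s a : initial_ideal f i a ->
  initial_ideal f i (pihomog [measure of mdeg] s a).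
Proof.
move=> [N [g [x [Xx ->]]]]; rewrite raddf_sum; apply: ideal_sum => j _.
have [h hi <-] := Xx j.
rewrite -[X in _ X]/(pihomog [measure of mdeg] s (g j * f h)) (pihomogM_homog _ _ (f_homog h)).
exact/ideal_mull/mem_initial.
Qed.

(** The component of the degree of [a] of a relation a = h f_i + b is again such a
    relation, because J_i is homogeneous; there h = 0 if that degree is less than
    that of f_i. *)
Lemma initialS_homog i s a : a \is s.-homog -> initial_ideal f i.+1 a ->
  exists h, [/\ initial_ideal f i (a - h * f i), (deg i <= s)%N \/ h = 0 &
    h \is (s - deg i).-homog].
Proof.
move=> ha /initialS[h hJ].
exists (if (deg i <= s)%N then pihomog [measure of mdeg] (s - deg i) h else 0).
split.
- rewrite -(pihomogM_homog _ _ (f_homog i)) -{1}(pihomog_dE ha).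
  by rewrite -raddfB; apply: initial_pihomog.
- by case: leqP; [left|right].
- by case: leqP => _; [exact: pihomogP|exact: dhomog0].
Qed.

End HomogeneousComponents.

Section GradedCochains.
Variables (k : fieldType) (n : nat).
Local Notation S := {mpoly k[n]}.
Local Notation X := (fun i : 'I_n => 'X_i : S).

Definition homog_piece (s : nat) : set S := [set a | a \is s.-homog].

Definition homog_loc (I : {set 'I_n}) (t : int) : set (loc (cech_prod X I)) :=
  loc_piece homog_piece (y := cech_prod X I) #|I| t.

Definition homog_cochain (t : int) (c : cochain X) : Prop :=
  forall I, homog_loc t (c I).

Lemma cech_prod_homog I : cech_prod X I \is #|I|.-homog.
Proof.
rewrite /cech_prod mprodXE dhomogX /= mdeg_sum -sum1_card.
by apply/eqP; apply: eq_bigr => i _; rewrite mdeg1.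
Qed.

Lemma homog_locD I t u v : homog_loc (I := I) t u -> homog_loc t v -> homog_loc t (u + v).
Proof.
move=> [->|[e [s [a [ha es ->]]]]]; first by rewrite add0r.
move=> [->|[l [s' [b [hb es' ->]]]]].
  by rewrite addr0; right; exists e, s, a.
right; exists (e + l)%N, (s + l * #|I|)%N, (cech_prod X I ^+ l * a + cech_prod X I ^+ e * b).
have hX h : cech_prod X I ^+ h \is (h * #|I|).-homog.
  by rewrite mulnC; apply: dhomogMn; apply: cech_prod_homog.
split; last by rewrite loc_fracD.
  rewrite /homog_piece /=; apply: rpredD; first by rewrite addnC; exact: (dhomogM (hX l) ha).
  have -> : (s + l * #|I| = e * #|I| + s')%N.
    by move: es es'; generalize (#|I|) => q; lia.
  exact: (dhomogM (hX e) hb).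
by lia.
Qed.

Lemma homog_loc0 I t : homog_loc (I := I) t 0. Proof. by left. Qed.

Lemma homog_locN I t u : homog_loc (I := I) t u -> homog_loc t (- u).
Proof.
move=> [->|[e [s [a [ha es ->]]]]]; first by left; rewrite oppr0.
right; exists e, s, (- a); split=> //; last by rewrite loc_fracN.
by rewrite /homog_piece /= dhomogN.
Qed.

Lemma homog_cochain_d t c : homog_cochain t c -> homog_cochain t (cech_d c).
Proof.
move=> hc I; rewrite /cech_d; elim/big_ind: _ => [||i iI]; first exact: homog_loc0.
  exact: homog_locD.
have eI := cech_prodD1 X iI.
suff hi : homog_loc t (loc_map (cech_prod X I) 'X_i (c (I :\ i))).
  by rewrite -signr_odd mulr_sign; case: odd => //; apply: homog_locN.
case: (hc (I :\ i)) => [->|[e [s [a [ha es ->]]]]]; first by left; rewrite loc_map0.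
right; exists e, (s + e)%N, (a * 'X_i ^+ e); split; last by rewrite (loc_mapE eI).
  have hX : ('X_i : S) \is 1.-homog by rewrite dhomogX /= mdeg1.
  by have := dhomogM ha (dhomogMn e hX); rewrite mul1n.
by rewrite (cardsD1 i I) iI; lia.
Qed.

Variables (f : nat -> S) (deg : nat -> nat).
Hypothesis f_homog : forall i, f i \is (deg i).-homog.

Lemma homog_loc_split i I t u :
  homog_loc (I := I) t u -> loc_ideal (initial_ideal f i.+1) u ->
  exists w, homog_loc (t - (deg i)%:Z) w /\
    loc_ideal (initial_ideal f i) (u - loc_scale (f i) w).
Proof.
move=> [->|[e [s [a [ha es ->]]]]].
  move=> _; exists 0; split; first exact: homog_loc0.
  by rewrite /loc_scale mulr0 subr0; apply: loc_ideal0.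
move=> /loc_idealE[N]; set y := cech_prod X I => aJ.
have hy : y ^+ N * a \is (N * #|I| + s).-homog.
  by apply: dhomogM => //; rewrite mulnC; apply: dhomogMn; apply: cech_prod_homog.
have [h [hJ sh hh]] := initialS_homog f_homog hy aJ.
exists (loc_frac y h (N + e)); split.
  case: sh => [sh|->]; last by left; apply: loc_frac0.
  by right; exists (N + e)%N, (N * #|I| + s - deg i)%N, h; split=> //; lia.
rewrite (loc_frac_shift _ a e N) loc_scaleE loc_fracN -loc_frac_addl (mulrC (f i)).
by exists (y ^+ N * a - h * f i), (N + e)%N.
Qed.

Lemma homog_cochain_split i j t z :
  cochain_mod (initial_ideal f i.+1) z -> cochain_degree_pred j z -> homog_cochain t z ->
  exists w, [/\ cochain_degree_pred j w, homog_cochain (t - (deg i)%:Z) w &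
    cochain_mod (initial_ideal f i) (z - f i *: w)].
Proof.
move=> Mz Ez hz.
have /dependent_choice[w wP] : forall I, exists w : loc (cech_prod X I),
    [/\ #|I|.+1 != j -> w = 0, homog_loc (t - (deg i)%:Z) w &
      loc_ideal (initial_ideal f i) (z I - loc_scale (f i) w)].
  move=> I; case: (eqVneq #|I|.+1 j) => [_|/Ez ->].
    by have [w [hw Mw]] := homog_loc_split (hz I) (Mz I); exists w.
  exists 0; split=> //; first exact: homog_loc0.
  by rewrite /loc_scale mulr0 subr0; apply: loc_ideal0.
exists w; split=> I; by have [] := wP I.
Qed.

End GradedCochains.

Section GradedQuotient.
Variables (k : fieldType) (n : nat) (J : ideal {mpoly k[n]}).
Local Notation S := {mpoly k[n]}.
Local Notation X := (fun i : 'I_n => 'X_i : S).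
Local Notation Xb := (quot_var J).

Lemma homog_cochain_lift j t (cb : cocycle Xb j) :
  (forall I, loc_piece (@quot_piece k n J) (y := cech_prod Xb I) #|I| t (cocycle_val cb I)) ->
  exists c, [/\ cochain_degree_pred j.+1 c, homog_cochain t c & cochain_quot J c = cocycle_val cb].
Proof.
case: cb => cb cbP /= hc; have /asboolP[cb0 _] := cbP.
have [I|c cP cE] := @cochain_quot_lift k n J cb
    (fun I u => (#|I|.+1 != j.+1 -> u = 0) /\ homog_loc t u).
  have eI := cech_prod_quot J I.
  case: (eqVneq #|I| j) => [Ij|Ij].
    case: (hc I) => [->|[e [s [_ [[a ha <-] es ->]]]]].
      by exists 0; [split=> //; left|apply: loc_quot0].
    exists (loc_frac _ a e); last exact: loc_quotE.
    by split=> [|//]; [rewrite Ij eqxx|right; exists e, s, a].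
  by exists 0; [split=> //; left|rewrite cb0 // loc_quot0].
by exists c; split=> // I; have [] := cP I.
Qed.

End GradedQuotient.

(** * Coordinates of a field over its p-th powers *)

Section PthPowerSums.
Variables (A : comPzRingType) (p : nat).
Hypothesis pA : char_p A p.

Lemma exprDp (a b : A) : (a + b) ^+ p = a ^+ p + b ^+ p.
Proof.
have B := pth_power_is_zmod_morphism pA.
by apply: (addIr (- b ^+ p)); rewrite -B !addrK.
Qed.

End PthPowerSums.

Section PthPowerBasis.
Variables (k : fieldType) (p : nat).
Hypothesis hp : p \in [pchar k].

Lemma pchar_char_p : char_p k p.
Proof. by case/andP: hp => pr /eqP. Qed.

Lemma mpoly_char_p n : char_p {mpoly k[n]} p.
Proof.
by have [pr p0] := pchar_char_p; split=> //; rewrite -(mpolyC_nat n k) p0 mpolyC0.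
Qed.

Definition pth_power_spanning N (e : 'I_N -> k) : Prop :=
  forall y, exists a : 'I_N -> k, y = \sum_(j < N) a j ^+ p * e j.

(** [lam j y] is the p-th root of the coordinate of [y] at [e j]. *)
Definition pth_power_coordinates N (e : 'I_N -> k) (lam : 'I_N -> k -> k) : Prop :=
  [/\ forall y, y = \sum_(j < N) lam j y ^+ p * e j,
      forall j a b, lam j (a + b) = lam j a + lam j b
    & forall j a b, lam j (a ^+ p * b) = a * lam j b].

(** A spanning family of minimal size is a basis of k over k^p, and uniqueness of
    coordinates makes their p-th roots additive and p^-1-linear. *)
Lemma pth_power_coordinates_exist : finite_over_pth_powers k p ->
  exists N (e : 'I_N -> k) lam, pth_power_coordinates e lam.
Proof.
move=> [N0 spanN0].
have : exists N, `[< exists e : 'I_N -> k, pth_power_spanning e >].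
  by exists N0; apply/asboolP.
move=> ex; case: (ex_minnP ex) => N /asboolP[e spane] minN {N0 spanN0 ex}.
have B := pth_power_is_zmod_morphism pchar_char_p.
have inj (a b : 'I_N -> k) :
    \sum_(j < N) a j ^+ p * e j = \sum_(j < N) b j ^+ p * e j -> a =1 b.
  move=> eab i; apply/eqP; apply: contraT => neq.
  pose d j := a j - b j.
  have d0 : \sum_(j < N) d j ^+ p * e j = 0.
    transitivity (\sum_(j < N) a j ^+ p * e j - \sum_(j < N) b j ^+ p * e j).
      by rewrite -sumrB; apply: eq_bigr => j _; rewrite -mulrBl -B.
    by rewrite eab subrr.
  have di : d i != 0 by rewrite subr_eq0.
  case: N e spane minN a b eab i neq @d d0 di => [|N] e spane minN a b eab i neq d d0 di.
    by have := ltn_ord i.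
  (* d i <> 0 allows e i to be eliminated, against minimality. *)
  have /minN : `[< exists e' : 'I_N -> k, pth_power_spanning e' >].
    apply/asboolP; exists (fun j => e (lift i j)) => y.
    have [c ->] := spane y; exists (fun j => c (lift i j) - c i / d i * d (lift i j)).
    have e0 : \sum_(j < N.+1) (c i / d i * d j) ^+ p * e j = 0.
      transitivity ((c i / d i) ^+ p * \sum_(j < N.+1) d j ^+ p * e j).
        by rewrite mulr_sumr; apply: eq_bigr => j _; rewrite exprMn mulrA.
      by rewrite d0 mulr0.
    transitivity (\sum_(j < N.+1) c j ^+ p * e j -
        \sum_(j < N.+1) (c i / d i * d j) ^+ p * e j); first by rewrite e0 subr0.
    rewrite -sumrB (bigD1_ord i) //= divfK // subrr add0r.
    by apply: eq_bigr => j _; rewrite B mulrBl.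
  by rewrite ltnn.
have [lam lamP] := choice spane; exists N, e, (fun j y => lam y j); split=> //.
- move=> j a b; apply: (inj (lam (a + b)) (fun j => lam a j + lam b j)).
  rewrite -lamP {1}(lamP a) {1}(lamP b) -big_split; apply: eq_bigr => i _ /=.
  by rewrite (exprDp pchar_char_p) mulrDl.
- move=> j a b; apply: (inj (lam (a ^+ p * b)) (fun j => a * lam b j)).
  rewrite -lamP {1}(lamP b) mulr_sumr; apply: eq_bigr => i _ /=.
  by rewrite exprMn mulrA.
Qed.

End PthPowerBasis.

(** * Monomial ideals *)

Section MonomialIdeals.
Variables (k : fieldType) (n : nat).
Local Notation S := {mpoly k[n]}.

Lemma mem_msuppMX (a : S) mu m :
  m \in msupp (a * 'X_[mu]) -> (mu <= m)%MM /\ (m - mu)%MM \in msupp a.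
Proof.
rewrite (perm_mem (msuppMX a mu)) => /mapP[m' am' ->].
by rewrite lem_addr addmC addmK.
Qed.

(** Every monomial of a multiple of X^v is divisible by X^v. *)
Lemma span_monomials (X : set S) (V : 'X_{1..n} -> Prop) (a : S) :
  (forall b, X b <-> exists2 v, V v & b = 'X_[v]) ->
  Defs.span X a <-> forall m, m \in msupp a -> exists2 v, V v & (v <= m)%MM.
Proof.
move=> XV; split=> [[N [g [x [Xx ->]]]] m|aV].
  move=> /(msupp_sum_le (P := predT)); rewrite filter_predT.
  move=> /flattenP[s /mapP[j _ ->]]; have [v Vv ->] := (XV _).1 (Xx j).
  by move=> /mem_msuppMX[vm _]; exists v.
rewrite [a]mpolyE; apply: (@big_ind _ (ideal_mem (Defs.span X))).
- exact: ideal0.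
- exact: idealD.
move=> m _; have [am|/memN_msupp_eq0 ->] := boolP (m \in msupp a); last first.
  by rewrite scale0r; apply: ideal0.
have [v Vv vm] := aV m am.
rewrite -(submK vm) mpolyXD scalerAl; apply/ideal_mull/mem_span.
by apply/XV; exists v.
Qed.

Lemma variable_powerE (i : 'I_n) e : ('X_i ^+ e : S) = 'X_[U_(i) *+ e].
Proof. exact: mpolyXn. Qed.

Lemma variable_power_le (i : 'I_n) e m : (U_(i) *+ e <= m)%MM = (e <= m i)%N.
Proof.
apply/mnm_lepP/idP => [/(_ i)|em j].
  by rewrite mulmnE mnm1E eqxx mul1n.
by rewrite mulmnE mnm1E; case: eqP => [<-|_]; rewrite ?mul1n.
Qed.

Definition power_ideal (e : nat) : ideal S := span_family (fun i : 'I_n => 'X_i ^+ e).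

Lemma power_idealP e a :
  power_ideal e a <-> forall m : 'X_{1..n}, (forall i, (m i < e)%N) -> a@_m = 0.
Proof.
have VE b : range (fun i : 'I_n => 'X_i ^+ e : S) b <->
    exists2 v, (exists i, v = (U_(i) *+ e)%MM) & b = 'X_[v].
  split=> [[i _ <-]|[_ [i ->] ->]]; last by exists i; rewrite // variable_powerE.
  by exists (U_(i) *+ e)%MM; [exists i|rewrite variable_powerE].
split=> [/(span_monomials _ VE) aV m me|aV].
  apply/eqP; rewrite mcoeff_eq0; apply/negP => /aV[_ [i ->]].
  by rewrite variable_power_le leqNgt me.
apply/(span_monomials _ VE) => m; rewrite mcoeff_msupp => am.
have [//|nV] := pselect (exists2 v, (exists i, v = (U_(i) *+ e)%MM) & (v <= m)%MM).
case/eqP: am; apply: aV => i; rewrite ltnNge -variable_power_le; apply/negP => le_em.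
by apply: nV; exists (U_(i) *+ e)%MM => //; exists i.
Qed.

Lemma irrelevant_idealP (a : S) : irrelevant_ideal k n a <-> a@_0 = 0.
Proof.
have -> : irrelevant_ideal k n a <-> power_ideal 1 a.
  by split; apply: span_le => _ [i _ <-]; apply: mem_span; exists i; rewrite // expr1.
rewrite power_idealP; split=> [|a0 m m0]; first by apply=> i; rewrite mnmE.
suff -> : m = 0%MM by [].
by apply/mnmP => i; rewrite mnmE; have := m0 i; case: (m i).
Qed.

(** A monomial times X_i is divisible by a variable of smaller index only if the
    monomial is. *)
Lemma variables_regular :
  partial_regular (extend_seq (fun i : 'I_n => 'X_i : S)) n.
Proof.
move=> i a lt_in.
pose V (v : 'X_{1..n}) := exists2 j : 'I_n, (j < i)%N & v = U_(j)%MM.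
have VE b : [set extend_seq (fun i : 'I_n => 'X_i : S) j | j in
    [set j : nat | (j < i)%N]]%classic b <-> exists2 v, V v & b = 'X_[v].
  split=> [[j ji <-]|[_ [j ji ->] ->]]; last first.
    by exists j => //; rewrite (extend_seqE _ j).
  exists U_(Ordinal (ltn_trans ji lt_in))%MM; first by exists (Ordinal (ltn_trans ji lt_in)).
  exact: (extend_seqE _ (Ordinal (ltn_trans ji lt_in))).
rewrite -[i in extend_seq _ i]/(nat_of_ord (Ordinal lt_in)) extend_seqE mulrC.
move=> /(span_monomials _ VE) aV; apply/(span_monomials _ VE) => m am.
have [|v [j ji ->]] := aV (U_(Ordinal lt_in) + m)%MM.
  by rewrite mcoeff_msupp mcoeffMX -mcoeff_msupp.
rewrite !lep1mP mnmDE mnm1E => mj; exists U_(j)%MM; first by exists j.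
rewrite lep1mP; move: mj; have [ij|//] := eqVneq (Ordinal lt_in) j.
by move: ji; rewrite -ij ltnn.
Qed.

Lemma monomial_in_power (m : 'X_{1..n}) :
  ideal_pow (irrelevant_ideal k n) (mdeg m) 'X_[m].
Proof.
apply: mem_span; move eqs: (mdeg m) => s.
elim: s m eqs => [|s IH] m ms.
  move/eqP: ms; rewrite mdeg_eq0 => /eqP ->.
  by exists (fun=> 0); split=> [[]//|]; rewrite big_ord0 mpolyX0.
have /existsP[i mi] : [exists i, m i != 0%N].
  rewrite -negb_forall; apply/negP => /forallP m0.
  move: ms; suff -> : m = 0%MM by rewrite mdeg0.
  by apply/mnmP => i; rewrite mnm0E; apply/eqP.
have im : (U_(i) <= m)%MM by rewrite lep1mP.
have [|g [gm gE]] := IH (m - U_(i))%MM.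
  by move: ms; rewrite -{1}(submK im) mdegD mdeg1 addn1 => -[].
exists (fun j => if unlift ord0 j is Some j' then g j' else 'X_i); split=> [j|].
  case: unliftP => [j' _|_]; first exact: gm.
  by apply: mem_span; exists i.
rewrite big_ord_recl unlift_none -[in LHS](submK im) addmC mpolyXD gE.
by congr (_ * _); apply: eq_bigr => j _; rewrite liftK.
Qed.

Lemma ideal_pow_low_degree s (a : S) m :
  ideal_pow (irrelevant_ideal k n) s a -> (mdeg m < s)%N -> a@_m = 0.
Proof.
move=> [N [g [x [Xx ->]]]] ms; rewrite raddf_sum big1 //= => i _.
have [h [hm ->]] := Xx i => {Xx}.
suff H r (P : 'I_r -> S) (b : S) mu : (forall j, irrelevant_ideal k n (P j)) ->
    (mdeg mu < r)%N -> (b * \prod_(j < r) P j)@_mu = 0 by apply: H.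
move=> Pm; elim: r P Pm b mu => // r IH P Pm b mu mur.
rewrite big_ord_recr /= mulrA mulrC mcoeffM big1 // => -[m1 m2] /= /eqP mE.
have [->|m10] := eqVneq (m1 : 'X_{1..n}) 0%MM.
  by have /irrelevant_idealP -> := Pm ord_max; rewrite mul0r.
rewrite IH ?mulr0 //.
have := congr1 mdeg mE; rewrite mdegD; move: m10; rewrite -mdeg_eq0; lia.
Qed.

End MonomialIdeals.

(** * Frobenius powers of ideals *)

Section FrobeniusCoordinates.
Variables (k : fieldType) (p : nat) (hp : p \in [pchar k]).
Variables (N : nat) (e : 'I_N -> k) (lam : 'I_N -> k -> k).
Hypothesis lamP : pth_power_coordinates p e lam.
Variable n : nat.
Local Notation S := {mpoly k[n]}.

Let p_gt0 : (0 < p)%N. Proof. by case: (pchar_char_p hp) => /prime_gt0. Qed.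
Let pS := mpoly_char_p hp n.

Lemma expr0p : 0 ^+ p = 0 :> S.
Proof. by rewrite expr0n (gtn_eqF p_gt0). Qed.

Lemma mpoly_exprDp (a b : S) : (a + b) ^+ p = a ^+ p + b ^+ p.
Proof. exact: exprDp. Qed.

Definition residue := {ffun 'I_n -> 'I_p}.
Definition residue_monomial (c : residue) : 'X_{1..n} := [multinom nat_of_ord (c i) | i < n].

Definition monomial_residue (m : 'X_{1..n}) : residue :=
  [ffun i => Ordinal (ltn_pmod (m i) p_gt0)].
Definition monomial_quotient (m : 'X_{1..n}) : 'X_{1..n} :=
  [multinom (m i %/ p)%N | i < n].

(** The products e_j X^c, with all exponents of X^c less than p, form a basis of S
    over S^p; this is the p-th root of the coordinate of [u] at e_j X^c. Taking the
    coefficients as the definition makes additivity and the effect on monomial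
    ideals immediate. *)
Definition frobenius_coordinate (j : 'I_N) (c : residue) (u : S) : S :=
  \sum_(m : 'X_{1..n < msize u}) lam j u@_(residue_monomial c + m *+ p)%MM *: 'X_[m].

Lemma lam0 j : lam j 0 = 0.
Proof.
have [_ lamD _] := lamP.
by apply: (addIr (lam j 0)); rewrite -lamD !add0r.
Qed.

Lemma mcoeff_coordinate j c u m :
  (frobenius_coordinate j c u)@_m = lam j u@_(residue_monomial c + m *+ p)%MM.
Proof.
rewrite /frobenius_coordinate.
case: (ltnP (mdeg m) (msize u)) => mu; first by
  rewrite (mcoeff_mpoly (fun m => lam j u@_(residue_monomial c + m *+ p)%MM)).
rewrite (memN_msupp_eq0 (msize_mdeg_ge (leq_trans mu _))); last first.
  by rewrite mdegD mdegMn; apply: leq_trans (leq_addl _ _); rewrite leq_pmulr.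
rewrite lam0 raddf_sum big1 //= => m' _; rewrite mcoeffZ mcoeffX.
case: eqP => [mm'|_]; last by rewrite mulr0.
by have := bmdeg m'; rewrite mm' ltnNge mu.
Qed.

Lemma coordinateD j c u v : frobenius_coordinate j c (u + v) =
  frobenius_coordinate j c u + frobenius_coordinate j c v.
Proof.
have [_ lamD _] := lamP; apply/mpolyP => m.
by rewrite mcoeffD !mcoeff_coordinate mcoeffD lamD.
Qed.

Lemma coordinate0 j c : frobenius_coordinate j c 0 = 0.
Proof. by apply/mpolyP => m; rewrite mcoeff_coordinate !mcoeff0 lam0. Qed.

Lemma monomial_division m :
  (residue_monomial (monomial_residue m) + monomial_quotient m *+ p)%MM = m.
Proof.
by apply/mnmP => i; rewrite mnmDE mulmnE !mnmE ffunE /= addnC -divn_eq.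
Qed.

Lemma residue_monomialD c m : monomial_residue (residue_monomial c + m *+ p)%MM = c.
Proof.
apply/ffunP => i; rewrite ffunE; apply: val_inj => /=.
by rewrite mnmDE mulmnE mnmE addnC modnMDl modn_small.
Qed.

Lemma coordinate_monomial j c a m : frobenius_coordinate j c (a *: 'X_[m]) =
  if monomial_residue m == c then lam j a *: 'X_[monomial_quotient m] else 0.
Proof.
apply/mpolyP => m'; rewrite mcoeff_coordinate mcoeffZ mcoeffX.
case: eqP => [mE|ne].
  have rE : monomial_residue m = c by rewrite mE residue_monomialD.
  rewrite rE eqxx mulr1 mcoeffZ mcoeffX.
  suff -> : monomial_quotient m = m' by rewrite eqxx mulr1.
  have := etrans (monomial_division m) mE; rewrite rE => /addmI qE.
  apply/mnmP => i; have := congr1 (fun mu : 'X_{1..n} => mu i) qE.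
  by rewrite !mulmnE => /eqP; rewrite eqn_pmul2r // => /eqP.
rewrite mulr0 lam0; case: eqP => [rE|_]; last by rewrite mcoeff0.
rewrite mcoeffZ mcoeffX; case: eqP => [qE|_]; last by rewrite mulr0.
by case: ne; rewrite -rE -qE monomial_division.
Qed.

Lemma coordinate_linear j c a u :
  frobenius_coordinate j c (a ^+ p * u) = a * frobenius_coordinate j c u.
Proof.
have [_ _ lamM] := lamP.
suff monomial b m : frobenius_coordinate j c ((b *: 'X_[m]) ^+ p * u) =
    (b *: 'X_[m]) * frobenius_coordinate j c u.
  elim/mpolyind: a => [|b m a _ _ IHa].
    by rewrite expr0p !mul0r coordinate0.
  by rewrite mpoly_exprDp !mulrDl coordinateD IHa monomial.
elim/mpolyind: u => [|d m' u _ _ IHu]; first by rewrite mulr0 coordinate0 mulr0.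
rewrite !mulrDr !coordinateD mulrDr IHu; congr (_ + _).
rewrite exprZn mpolyXn -scalerAl -scalerAr scalerA -mpolyXD.
rewrite !coordinate_monomial lamM.
have -> : monomial_residue (m *+ p + m')%MM = monomial_residue m'.
  apply/ffunP => i; rewrite !ffunE; apply: val_inj => /=.
  by rewrite mnmDE mulmnE modnMDl.
have -> : monomial_quotient (m *+ p + m')%MM = (m + monomial_quotient m')%MM.
  by apply/mnmP => i; rewrite !mnmE mulmnE divnMDl.
case: eqP => _; last by rewrite mulr0.
by rewrite mpolyXD -scalerAl -scalerAr scalerA.
Qed.

Lemma coordinate_decomposition u : u =
  \sum_(j < N) \sum_(c : residue)
    e j *: 'X_[residue_monomial c] * frobenius_coordinate j c u ^+ p.
Proof.
have [lamE _ _] := lamP.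
elim/mpolyind: u => [|a m u _ _ IHu].
  rewrite big1 // => j _; rewrite big1 // => c _.
  by rewrite coordinate0 expr0p mulr0.
have split j v w :
    \sum_c e j *: 'X_[residue_monomial c] * frobenius_coordinate j c (v + w) ^+ p =
    \sum_c e j *: 'X_[residue_monomial c] * frobenius_coordinate j c v ^+ p +
    \sum_c e j *: 'X_[residue_monomial c] * frobenius_coordinate j c w ^+ p.
  by rewrite -big_split; apply: eq_bigr => c _; rewrite coordinateD mpoly_exprDp mulrDr.
rewrite (eq_bigr _ (fun j _ => split j _ _)) big_split /= -IHu; congr (_ + _).
rewrite {1}(lamE a) scaler_suml; apply: eq_bigr => j _.
rewrite (bigD1 (monomial_residue m)) //= big1 ?addr0 => [|c cm].
  rewrite coordinate_monomial eqxx exprZn mpolyXn.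
  rewrite -scalerAl -scalerAr scalerA -mpolyXD monomial_division.
  by rewrite mulrC.
rewrite coordinate_monomial eq_sym (negPf cm).
by rewrite expr0p mulr0.
Qed.

(** S is free over S^p, so membership in I^[p] is tested on coordinates. *)
Lemma frobenius_powerP (I : ideal S) u :
  frobenius_power p I u <-> forall j c, I (frobenius_coordinate j c u).
Proof.
split=> [[M [g [x [Ix ->]]]] j c|Iu].
  rewrite (big_morph (frobenius_coordinate j c) (coordinateD j c) (coordinate0 j c)).
  apply: ideal_sum => i _; have [a Ia <-] := Ix i.
  by rewrite mulrC coordinate_linear; apply: ideal_mulr.
rewrite (coordinate_decomposition u); apply: ideal_sum => j _; apply: ideal_sum => c _.
by apply/ideal_mull/mem_span; exists (frobenius_coordinate j c u).
Qed.

Lemma coordinate_power_ideal d j c u :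
  power_ideal k n (d * p) u -> power_ideal k n d (frobenius_coordinate j c u).
Proof.
move=> /power_idealP u0; apply/power_idealP => m md.
rewrite mcoeff_coordinate u0 ?lam0 // => i.
rewrite mnmDE mulmnE mnmE; have := md i; have := ltn_ord (c i); nia.
Qed.

End FrobeniusCoordinates.

(** * The top local cohomology of the polynomial ring *)

Section TopCohomology.
Variables (k : fieldType) (n : nat).
Local Notation S := {mpoly k[n]}.
Local Notation X := (fun i : 'I_n => 'X_i : S).
Local Notation top := (cech_prod X [set: 'I_n]).

Lemma cech_prod_top_power d : top ^+ d = 'X_[[multinom d | _ < n]].
Proof.
rewrite /cech_prod mprodXE mpolyXn.
suff -> : ((\sum_(i in [set: 'I_n]) U_(i)) *+ d = [multinom d | _ < n])%MM by [].
apply/mnmP => i.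
rewrite [RHS]mnmE mulmnE mnm_sumE (bigD1 i) ?inE //= mnm1E eqxx big1 ?addn0 ?mul1n //.
by move=> j /andP[_ /negPf ji]; rewrite mnm1E ji.
Qed.

(** A colon ideal of monomial ideals: multiplication by (X_1 ... X_n)^l translates
    the box of exponents outside the ideal by l in every direction. *)
Lemma power_ideal_shift d l a :
  power_ideal k n (d + l) (top ^+ l * a) <-> power_ideal k n d a.
Proof.
rewrite cech_prod_top_power mulrC !power_idealP; split=> a0 m md.
  rewrite -(mcoeffMX a [multinom l | _ < n] m) a0 // => i.
  by rewrite mnmDE mnmE addnC ltn_add2r.
apply/eqP; rewrite mcoeff_eq0; apply/negP => /mem_msuppMX[lm].
rewrite mcoeff_msupp a0 ?eqxx // => i; rewrite mnmBE mnmE.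
by have /mnm_lepP/(_ i) := lm; rewrite mnmE; have := md i; lia.
Qed.

(** These fractions are the zero elements of H^n(S), see [top_coboundary]. *)
Definition top_boundary (u : loc top) : Prop :=
  exists a d, power_ideal k n d a /\ u = loc_frac top a d.

Lemma top_neq0 d : top ^+ d != 0.
Proof.
by rewrite cech_prod_top_power -msupp_eq0 msuppX.
Qed.

Lemma top_boundaryE a d : top_boundary (loc_frac top a d) <-> power_ideal k n d a.
Proof.
split=> [[b [l [bl /loc_fracP[M eM]]]]|]; last by exists a, d.
have /(mulfI (top_neq0 M)) ab := eM.
apply/(power_ideal_shift d l); rewrite ab addnC.
exact/power_ideal_shift.
Qed.

Lemma top_boundaryD u v : top_boundary u -> top_boundary v -> top_boundary (u + v).
Proof.
move=> [a [d [ad ->]]] [b [l [bl ->]]]; rewrite loc_fracD.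
exists (top ^+ l * a + top ^+ d * b), (d + l)%N; split=> //; apply: idealD.
  exact/power_ideal_shift.
rewrite addnC; exact/power_ideal_shift.
Qed.

Lemma top_boundaryN u : top_boundary u -> top_boundary (- u).
Proof.
move=> [a [d [ad ->]]]; exists (- a), d; rewrite loc_fracN.
by split=> //; apply: idealN.
Qed.

(** The component of a cochain of degree n - 1 at the complement of i is a fraction
    h / (X_1 ... X_n / X_i)^d, and equals h X_i^d / (X_1 ... X_n)^d in the top
    localization. *)
Lemma top_coboundary (y : cochain X) : cochain_degree_pred n.+1 y ->
  (exists2 b, cochain_degree_pred n b & y = cech_d b) <-> top_boundary (y [set: 'I_n]).
Proof.
move=> Ey; split=> [[b Eb ->]|].
  rewrite /cech_d; elim/big_ind: _ => [||i iT].
  - by exists 0, 0%N; split; [exact: ideal0|rewrite loc_frac0].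
  - exact: top_boundaryD.
  have eT := cech_prodD1 X iT.
  suff tb : top_boundary (loc_map top 'X_i (b ([set: 'I_n] :\ i))).
    by rewrite -signr_odd mulr_sign; case: odd => //; apply: top_boundaryN.
  have [a [d ->]] := loc_fracE (b ([set: 'I_n] :\ i)).
  exists (a * 'X_i ^+ d), d; rewrite (loc_mapE eT); split=> //.
  by apply/ideal_mull/mem_span; exists i.
case: (loc_fracE (y [set: 'I_n])) => a [d yE]; rewrite yE => /top_boundaryE ad.
have [h hE] : exists h : 'I_n -> S, a = \sum_i h i * 'X_i ^+ d.
  have [M [g [x [Xx ->]]]] := ad.
  elim/big_ind: _ => [|u v [h ->] [h' ->]|j _].
  - by exists (fun=> 0); rewrite big1 // => i _; rewrite mul0r.
  - exists (fun i => h i + h' i); rewrite -big_split.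
    by apply: eq_bigr => i _; rewrite mulrDl.
  have [i _ <-] := Xx j; exists (fun i' => if i' == i then g j else 0).
  rewrite (bigD1 i) //= eqxx big1 ?addr0 // => i' /negPf ->.
  by rewrite mul0r.
(* The only missing index of a set with n - 1 elements is found by [pick]. *)
pose b : cochain X := fun I =>
  if [pick i | i \notin I] is Some i then
    if #|I|.+1 == n then loc_frac (cech_prod X I) ((-1) ^+ cech_sign [set: 'I_n] i * h i) d
    else 0
  else 0.
have Eb : cochain_degree_pred n b.
  by move=> I In; rewrite /b; case: pickP => // i _; rewrite (negPf In).
exists b => //; apply: functional_extensionality_dep => I.
have [->|IT] := eqVneq I [set: 'I_n]; last first.
  rewrite (cochain_degree_pred_d Eb) ?Ey //; apply: contra IT; rewrite eqSS => /eqP In.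
  - by rewrite eqEcard finset.subsetT cardsT card_ord In leqnn.
  - by rewrite eqEcard finset.subsetT cardsT card_ord In leqnn.
rewrite yE /cech_d hE.
have -> : loc_frac top (\sum_i h i * 'X_i ^+ d) d = \sum_i loc_frac top (h i * 'X_i ^+ d) d.
  by apply: (big_morph (fun u => loc_frac top u d)) => [u v|];
     rewrite ?loc_frac_addl ?loc_frac0.
apply: eq_big => [i|i _]; first by rewrite inE.
have eT := cech_prodD1 X (finset.in_setT i).
rewrite /b; case: pickP => [i'|/(_ i)]; last by rewrite !inE eqxx.
rewrite !inE andbT negbK => /eqP ->.
have -> : #|[set: 'I_n] :\ i|.+1 == n.
  by have := cardsD1 i [set: 'I_n]; rewrite finset.in_setT add1n cardsT card_ord => <-.
rewrite (loc_mapE eT) -mulrA.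
have -> : loc_frac top ((-1) ^+ cech_sign [set: 'I_n] i * (h i * 'X_i ^+ d)) d =
    (-1) ^+ cech_sign [set: 'I_n] i * loc_frac top (h i * 'X_i ^+ d) d.
  rewrite -signr_odd -[in RHS]signr_odd !mulr_sign.
  by case: odd; rewrite ?loc_fracN.
by rewrite mulrA -expr2 sqrr_sign mul1r.
Qed.

(** All homogeneous components of [u] have degree less than [t]. *)
Definition low_degree (t : int) (u : loc top) : Prop :=
  exists a d, (forall m : 'X_{1..n}, m \in msupp a -> (mdeg m)%:Z < t + (d * n)%N%:Z) /\
    u = loc_frac top a d.

Lemma low_degree0 t : low_degree t 0.
Proof. by exists 0, 0%N; rewrite loc_frac0; split=> // m; rewrite msupp0. Qed.

Lemma low_degreeD t u v : low_degree t u -> low_degree t v -> low_degree t (u + v).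
Proof.
move=> [a [d [ad ->]]] [b [l [bl ->]]]; rewrite loc_fracD.
exists (top ^+ l * a + top ^+ d * b), (d + l)%N; split=> // m.
have E c : mdeg [multinom c | _ < n] = (c * n)%N.
  rewrite mdegE; under eq_bigr => i _ do rewrite mnmE.
  by rewrite sum_nat_const card_ord mulnC.
move=> /msuppD_le; rewrite mem_cat !cech_prod_top_power [_ * a]mulrC [_ * b]mulrC.
move=> /orP[] /mem_msuppMX[/submK mE].
  by move=> /ad; rewrite -[in X in _ -> X]mE mdegD E; lia.
by move=> /bl; rewrite -[in X in _ -> X]mE mdegD E; lia.
Qed.

Lemma homog_low_degree s t (u : loc top) : s < t -> homog_loc s u -> low_degree t u.
Proof.
move=> st [->|[d [r [a [ha es ->]]]]]; first exact: low_degree0.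
exists a, d; split=> // m am; have /dhomogP/(_ m am) /= -> := ha.
by move: es; rewrite cardsT card_ord; lia.
Qed.

(** The socle of S/(X_1^d, ..., X_n^d) is spanned by X^(d-1, ..., d-1). If a
    monomial X^m of [a] is outside the ideal, multiplication by X^r takes it to the
    socle for r = (d-1, ..., d-1) - m, and the degree bound makes deg X^r > l. *)
Lemma power_ideal_low_degree l a d :
  (forall m : 'X_{1..n}, m \in msupp a -> (mdeg m)%:Z < - n%:Z - l%:Z + (d * n)%N%:Z) ->
  (forall s b, (l < s)%N -> ideal_pow (irrelevant_ideal k n) s b -> power_ideal k n d (b * a)) ->
  power_ideal k n d a.
Proof.
move=> low kill; apply/power_idealP => m md; apply/eqP; rewrite mcoeff_eq0.
apply/negP => am.
pose r : 'X_{1..n} := [multinom d.-1 - m i | i < n].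
have rm : (r + m = [multinom d.-1 | i < n])%MM.
  by apply/mnmP => i; rewrite mnmDE !mnmE; have := md i; lia.
have degr : (mdeg r + mdeg m = d.-1 * n)%N.
  rewrite -mdegD rm mdegE; under eq_bigr => i _ do rewrite mnmE.
  by rewrite sum_nat_const card_ord mulnC.
have lr : (l < mdeg r)%N by have := low m am; case: (d) degr => [|d']; nia.
have /power_idealP/(_ (r + m)%MM) := kill _ _ lr (monomial_in_power k r).
rewrite mulrC mcoeffMX => ra; move: am; rewrite mcoeff_msupp ra ?eqxx // => i.
by rewrite rm mnmE; have := md i; lia.
Qed.

End TopCohomology.

(** * The smallest ideal whose Frobenius power contains g *)

Section PrimeAvoidingPowers.
Variables (S : comNzRingType) (T : ideal S) (a : S).
Hypothesis Ta : forall s, ~ T (a ^+ s).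
Local Open Scope classical_set_scope.

(** Joining [T] to the set makes the empty chain bounded in Zorn's lemma. *)
Let good (A : set S) : Prop :=
  is_ideal (A `|` T) /\ forall s, ~ (A `|` T) (a ^+ s).

Lemma good_chain (F : set (set S)) : F `<=` good -> total_on F subset ->
  good (\bigcup_(X in F) X).
Proof.
move=> Fgood Ftot; set U := \bigcup_(X in F) X.
have local1 u : (U `|` T) u -> T u \/ exists2 X, F X & (X `|` T) u.
  by move=> [[X FX Xu]|Tu]; [right; exists X => //; left|left].
have up X u : F X -> (X `|` T) u -> (U `|` T) u.
  by move=> FX [Xu|Tu]; [left; exists X|right].
have sub X Y u : X `<=` Y -> (X `|` T) u -> (Y `|` T) u.
  by move=> XY [/XY|]; [left|right].
have local2 u v : (U `|` T) u -> (U `|` T) v ->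
    (T u /\ T v) \/ exists X, [/\ F X, (X `|` T) u & (X `|` T) v].
  move=> /local1[Tu|[X FX Xu]] /local1[Tv|[Y FY Yv]]; first by left.
  - by right; exists Y; split=> //; right.
  - by right; exists X; split=> //; right.
  - right; have [XY|YX] := Ftot X Y FX FY.
      by exists Y; split=> //; apply: sub Xu.
    by exists X; split=> //; apply: sub Yv.
split; last first.
  by move=> s /local1[/Ta //|[X FX]]; have [_] := Fgood X FX; apply.
split=> [|u v Uu Uv|b u Uu].
- by right; apply: ideal0.
- have [[Tu Tv]|[X [FX Xu Xv]]] := local2 u v Uu Uv; first by right; apply: idealD.
  by apply: (up X) => //; have [[_ D _] _] := Fgood X FX; apply: D.
- have [Tu|[X FX Xu]] := local1 u Uu; first by right; apply: ideal_mull.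
  by apply: (up X) => //; have [[_ _ D] _] := Fgood X FX; apply: D.
Qed.

(** An ideal that is maximal among those that contain T and no power of a is
    prime: if b and b' were outside it, joining either one would produce a power of
    a, and the product of these two powers would lie in the ideal with b b'. *)
Lemma prime_avoiding_powers : exists P, [/\ prime_ideal P, ideal_le T P & ~ P a].
Proof.
have [A [[idA Aa] maxA]] := Zorn_bigcup good_chain.
pose P : ideal S := Ideal idA.
have TP : ideal_le T P by move=> u Tu; right.
have large b : ~ P b -> exists s r, P (a ^+ s - r * b).
  move=> Pb; pose Q := Defs.span (P `|` [set b]).
  have PQ u : P u -> Q u by move=> Pu; apply: mem_span; left.
  have QE u : Q u -> exists r, P (u - r * b).
    move=> [N [g [x [Xx ->]]]].
    elim/big_ind: _ => [|v w [r vr] [r' wr]|j _].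
    - by exists 0; rewrite mul0r subr0; apply: ideal0.
    - by exists (r + r'); rewrite mulrDl opprD addrACA; apply: idealD.
    - have [Pxj|->] := Xx j; last by exists (g j); rewrite subrr; apply: ideal0.
      by exists 0; rewrite mul0r subr0; apply: ideal_mull.
  have QT : Q `|` T = Q.
    by apply/seteqP; split=> u; [case=> // /TP/PQ|left].
  have [Qa|nQa] := pselect (exists s, Q (a ^+ s)).
    by have [s /QE[r]] := Qa; exists s, r.
  case: (maxA Q).
    split; first by move=> u Au; apply: PQ; left.
    move=> QA; apply: Pb; left; apply: QA; apply: mem_span; by right.
  by split; rewrite QT; [exact: idealP|move=> s Qs; apply: nQa; exists s].
exists P; split=> //; last by move: (Aa 1%N); rewrite expr1.
split=> [|b b' Pbb']; first exact: (Aa 0%N).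
have [Pb|/large[s [r Ps]]] := pselect (P b); first by left.
have [Pb'|/large[t [r' Pt]]] := pselect (P b'); first by right.
case: (Aa (s + t)%N); rewrite -/(P _) exprD.
have -> : a ^+ s * a ^+ t = a ^+ t * (a ^+ s - r * b) +
    ((r * b) * (a ^+ t - r' * b') + (r * r') * (b * b')) by ring.
apply: (@idealD _ P); first exact: ideal_mull.
by apply: idealD; apply: ideal_mull.
Qed.

End PrimeAvoidingPowers.

Lemma frobenius_power_le (S : comNzRingType) p (I I' : ideal S) :
  ideal_le I I' -> ideal_le (frobenius_power p I) (frobenius_power p I').
Proof.
move=> II'; apply: span_le => _ [a /II' Ia <-]; apply: mem_span.
by exists a.
Qed.

Section TestIdeal.
Variables (k : fieldType) (p : nat) (hp : p \in [pchar k]).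
Hypothesis hfin : finite_over_pth_powers k p.
Variable n : nat.
Local Notation S := {mpoly k[n]}.
Local Notation m := (irrelevant_ideal k n).
Variables (J : ideal S) (g : S).

Definition frobenius_root_ideal (I : ideal S) : Prop :=
  ideal_le J I /\ frobenius_power p I g.

(** Generated by J and the p-th roots of the coordinates of g, by [frobenius_powerP]. *)
Lemma smallest_root_exists : exists tau, smallest_ideal frobenius_root_ideal tau.
Proof.
have [N [e [lam lamP]]] := pth_power_coordinates_exist hp hfin.
pose root (a : S) := exists j (c : residue p n), a = frobenius_coordinate lam j c g.
exists (Defs.span [set a | J a \/ root a]%classic); split.
  split; first by move=> a Ja; apply: mem_span; left.
  apply/(frobenius_powerP hp lamP) => j c; apply: mem_span; right.
  by exists j, c.
move=> I [JI /(frobenius_powerP hp lamP) Ig]; apply: span_le => a [/JI //|].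
by move=> [j [c ->]].
Qed.

Hypothesis prime_avoid : forall P : ideal S, prime_ideal P ->
  (P : S -> Prop) <> m -> ideal_le J P -> ~ frobenius_power p P g.
Hypothesis root_m : frobenius_root_ideal m.
Variable tau : ideal S.
Hypothesis tauP : smallest_ideal frobenius_root_ideal tau.

Lemma smallest_root_le : ideal_le tau m.
Proof. exact: tauP.2. Qed.

(** An element of m outside the radical is avoided by a prime P containing tau.
    Then P is not m, but g lies in tau^[p] and so in P^[p]. *)
Lemma radical_smallest_root : radical tau = m.
Proof.
apply: funext => a; apply: propext; split=> [[s /smallest_root_le]|ma].
  move=> /irrelevant_idealP; rewrite (rmorphXn (mcoeff 0%MM)) => /eqP.
  rewrite expf_eq0 => /andP[_ /eqP a0]; exact/irrelevant_idealP.
have [//|/forallNP ntau] := pselect (radical tau a).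
have [P [primeP tauPP Pa]] := prime_avoiding_powers ntau.
have [Jtau gtau] := tauP.1.
case: (@prime_avoid P) => //.
- by move=> Pm; apply: Pa; rewrite Pm.
- by move=> b /Jtau; apply: tauPP.
- exact: frobenius_power_le gtau.
Qed.

(** One exponent e puts all the X_i^e in tau, hence all the monomials of degree
    greater than n e. *)
Lemma socle_bound_exists :
  exists l, is_max_nat (fun s => ~ ideal_le (ideal_pow m s) tau) l.
Proof.
have [|e Xe] := uniform_exponent (T := 'I_n) (P := fun i e => tau ('X_i ^+ e)).
  move=> i; have : radical tau 'X_i.
    by rewrite radical_smallest_root; apply: mem_span; exists i.
  by move=> [e te]; exists e => e' /subnK <-; rewrite exprD; apply: ideal_mull.
have bound s : ~ ideal_le (ideal_pow m s) tau -> (s <= n * e)%N.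
  move=> nle; rewrite leqNgt; apply/negP => lt_s; apply: nle => a ma.
  suff : power_ideal k n e a by apply: span_le => _ [i _ <-].
  apply/power_idealP => mu mue; apply: ideal_pow_low_degree ma _.
  apply: leq_ltn_trans lt_s; rewrite mdegE -[X in (_ <= X * _)%N]card_ord -sum_nat_const.
  by apply: leq_sum => i _; apply: ltnW.
have ex : exists s, `[< ~ ideal_le (ideal_pow m s) tau >].
  exists 0%N; apply/asboolP => le0.
  have /smallest_root_le/irrelevant_idealP/eqP : tau 1.
    apply: le0; apply: mem_span; exists (fun=> 0); split; first by case.
    by rewrite big_ord0.
  by rewrite mcoeff1 eqxx oner_eq0.
case: (ex_maxnP (P := fun s => `[< ~ ideal_le (ideal_pow m s) tau >]) ex (m := (n * e)%N)).
  by move=> s /asboolP/bound.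
move=> l /asboolP lP maxl; exists l; split=> // s sP.
by apply: maxl; apply/asboolP.
Qed.

End TestIdeal.

(** * The Frobenius action on the local cohomology of a complete intersection *)

Section CompleteIntersection.
Variables (k : fieldType) (p : nat) (hp : p \in [pchar k]) (n c : nat).
Local Notation S := {mpoly k[n]}.
Local Notation X := (fun i : 'I_n => 'X_i : S).
Variables (f : nat -> S) (deg : nat -> nat) (J : ideal S).
Hypothesis f_homog : forall i, f i \is (deg i).-homog.
Hypothesis deg_gt0 : forall i, (i < c)%N -> (0 < deg i)%N.
Hypothesis f_regular : partial_regular f c.
Hypothesis JE : forall a, J a <-> initial_ideal f c a.
Local Notation d := (@cech_d S n X).
Local Notation E := (@cochain_degree_pred S n X).
Local Notation M := (fun i => @cochain_mod S n X (initial_ideal f i)).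
Local Notation Xb := (quot_var J).
Local Notation m := (irrelevant_ideal k n).
Let cplx := cech_complex_mod X f_regular.
Let p_gt0 : (0 < p)%N. Proof. by case: (pchar_char_p hp) => /prime_gt0. Qed.

Lemma cochain_modE u : cochain_mod J u <-> M c u.
Proof. by split=> Mu I; apply: loc_ideal_le (Mu I) => a /JE. Qed.

Lemma homog_positive_irrelevant i : (i < c)%N -> m (f i).
Proof.
move=> ic; apply/irrelevant_idealP; apply: (dhomog_nemf_coeff (f_homog i)).
by rewrite /= mdeg0 eq_sym -lt0n deg_gt0.
Qed.

Lemma acyclic_variables j : (j < n)%N -> acyclic_mod d E M 0 j.
Proof. exact/cech_acyclic/variables_regular. Qed.

Lemma coboundary_top y : E n.+1 y ->
  coboundary_mod d E M 0 n y <-> top_boundary (y [set: 'I_n]).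
Proof.
move=> Ey; rewrite -(top_coboundary Ey); split=> [] [b Eb bE]; exists b => //.
  apply/eqP; rewrite -subr_eq0; apply/eqP.
  by apply: functional_extensionality_dep => I; apply: loc_ideal_initial0 (bE I).
by rewrite bE subrr => I; apply: loc_ideal0.
Qed.

(** The socle element 1 / (X_1 ... X_n) of H^n(S) is nonzero and killed by every
    form of positive degree, so [regular_length_le] applies to it. *)
Lemma codim_le : (c <= n)%N.
Proof.
pose y : cochain X := fun I => if #|I| == n then loc_frac (cech_prod X I) 1 1 else 0.
have Ey : E n.+1 y by move=> I; rewrite eqSS /y => /negPf ->.
have yT : y [set: 'I_n] = loc_frac (cech_prod X [set: 'I_n]) 1 1.
  by rewrite /y cardsT card_ord eqxx.
apply: (regular_length_le cplx acyclic_variables Ey) => [|i ic].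
  move/(coboundary_top Ey); rewrite yT => /top_boundaryE/power_idealP/(_ 0%MM) one0.
  have /eqP : (1 : S)@_0 = 0 by apply: one0 => i; rewrite mnm0E.
  by rewrite mcoeff1 eqxx oner_eq0.
apply/coboundary_top; first exact: (submoduleZ (cochain_degree_pred_submodule _ _)).
rewrite cochainZ yT loc_scaleE mulr1; apply/top_boundaryE.
have := homog_positive_irrelevant ic; apply: span_le => _ [j _ <-].
by apply: mem_span; exists j; rewrite // expr1.
Qed.

Local Notation j := (n - c)%N.

Lemma codim_addK : (j + c)%N = n. Proof. exact/subnK/codim_le. Qed.

(** [y] is a cochain for the image of [h] in H^n(S), and the bound on its degree is
    what [h] having degree less than [t] becomes under the connecting maps. *)
Definition represented (t : int) (h : local_cohomology J j) : Prop :=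
  exists (z y : cochain X) (cb : cocycle Xb j),
    [/\ h = cohomology_class cb, cochain_quot J z = cocycle_val cb, E j.+1 z,
        connected d E f M c j.+1 z y
      & E n.+1 y /\ low_degree (t - (\sum_(i < c) deg i)%N%:Z) (y [set: 'I_n])].

Lemma cochain_quotD u v : cochain_quot J (u + v) = cochain_quot J u + cochain_quot J v.
Proof.
apply: (addIr (- cochain_quot J v)).
by rewrite -cochain_quotB !addrK.
Qed.

Lemma represented0 t : represented t 0.
Proof.
exists 0, 0, 0; split; rewrite ?raddf0 //.
- by rewrite -(subrr 0) cochain_quotB subrr.
- exact: connected0 cplx _ _.
- by split=> //; apply: low_degree0.
Qed.

Lemma represented_add t h h' :
  represented t h -> represented t h' -> represented t (h + h').
Proof.
move=> [z [y [cb [-> zE Ez zy [Ey ly]]]]] [z' [y' [cb' [-> zE' Ez' zy' [Ey' ly']]]]].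
exists (z + z'), (y + y'), (cb + cb'); split.
- by rewrite raddfD.
- by rewrite cochain_quotD zE zE'.
- exact: (submoduleD (cochain_degree_pred_submodule _ _)).
- exact: (connected_add cplx).
- split; first exact: (submoduleD (cochain_degree_pred_submodule _ _)).
  by rewrite cochainD; apply: low_degreeD.
Qed.

Lemma represented_opp t h : represented t h -> represented t (- h).
Proof.
move=> [z [y [cb [-> zE Ez zy [Ey ly]]]]].
exists ((-1) *: z), ((-1) *: y), (- cb); split.
- by rewrite raddfN.
- by rewrite scaleN1r -sub0r cochain_quotB zE -(subrr 0) cochain_quotB subrr sub0r.
- exact: (submoduleZ (cochain_degree_pred_submodule _ _)).
- exact: (connected_scale cplx).
- split; first exact: (submoduleZ (cochain_degree_pred_submodule _ _)).
  rewrite cochainZ; have [a [e [ae ->]]] := ly; exists (- a), e.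
  by rewrite loc_scaleE mulN1r; split=> // mu; rewrite (perm_mem (msuppN a)); apply: ae.
Qed.

Lemma cocycle_lift_mod (cb : cocycle Xb j) z :
  cochain_quot J z = cocycle_val cb -> M c (d z).
Proof.
move=> zE; apply/cochain_modE/cochain_quot_eq0.
rewrite cochain_quot_d zE; case: cb zE => cb cbP _ /=.
by have /asboolP[] := cbP.
Qed.

Lemma represented_piece s t h : s < t ->
  cohomology_piece (@quot_piece k n J) (x := Xb) (i := j) s h -> represented t h.
Proof.
move=> st [cb [hcb ->]]; have [z [Ez hz zE]] := homog_cochain_lift hcb.
have [||y [zy Ey hy]] := connected_exists cplx (G := @homog_cochain k n) (e := deg)
   _ _ (leqnn c) Ez hz (cocycle_lift_mod zE).
- exact: homog_cochain_d.
- by move=> i j' t' u _; apply: homog_cochain_split.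
exists z, y, cb; split=> //; split; first by rewrite addSn codim_addK in Ey.
by apply: homog_low_degree (hy _); rewrite ltrD2r.
Qed.

Lemma represented_lt t h : local_cohomology_lt t h -> represented t h.
Proof.
move=> [N [s [g [gP ->]]]]; elim/big_ind: _ => [||i _].
- exact: represented0.
- exact: represented_add.
- by have [si gi] := gP i; apply: represented_piece gi.
Qed.

Let phi := @cochain_frobenius S n X p.

Lemma cochain_frobeniusZ a u : phi (a *: u) = a ^+ p *: phi u.
Proof.
apply: functional_extensionality_dep => I.
by rewrite /phi /cochain_frobenius !cochainZ /loc_scale exprMn loc_fracX mul0n.
Qed.

Lemma connected_twisted_frobenius z y : connected d E f M c j.+1 z y ->
  connected d E f M c j.+1 (phi z) ((\prod_(i < c) f i) ^+ p.-1 *: phi y).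
Proof.
apply: (connected_frobenius cplx p_gt0).
- exact: (cochain_frobenius_is_zmod_morphism (mpoly_char_p hp n)).
- exact: cochain_frobeniusZ.
- by move=> u; exact: (esym (cochain_frobenius_d (mpoly_char_p hp n) u)).
- by move=> i u Eu I Ii; rewrite /phi /cochain_frobenius Eu // expr0n; case: (p) p_gt0.
- by move=> i u Mu I; apply: loc_idealX.
Qed.

(** With y = a / (X_1 ... X_n)^e the image of [h], the ideal of all b with b y = 0
    in H^n(S) contains J, and g lies in its Frobenius power because g y^p = 0. So
    it contains tau, and [power_ideal_low_degree] forces y = 0. *)
Lemma frobenius_injective_lt (hfin : finite_over_pth_powers k p) tau l h :
  smallest_ideal (frobenius_root_ideal p J ((\prod_(i < c) f i) ^+ p.-1)) tau ->
  (forall s, (l < s)%N -> ideal_le (ideal_pow m s) tau) ->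
  represented (- n%:Z + (\sum_(i < c) deg i)%N%:Z - l%:Z) h ->
  @frobenius_action k n J p hp j h = 0 -> h = 0.
Proof.
set g := _ ^+ p.-1 => tauP powl [z [y [cb [-> zE Ez zy [Ey ly]]]]].
rewrite /frobenius_action cohomology_frobeniusE.
have phizE : cochain_quot J (phi z) =
    cocycle_val (cocycle_frobenius (quot_char_p J hp) cb).
  by rewrite (cochain_quot_frobenius J hp) zE.
move=> /(cohomology_class_eq0 phizE)[b Eb Mb].
have Ephiz : E j.+1 (phi z).
  by move=> I Ii; rewrite /phi /cochain_frobenius Ez // expr0n; case: (p) p_gt0.
have Egy : E n.+1 (g *: phi y).
  apply: (submoduleZ (cochain_degree_pred_submodule _ _)) => I Ii.
  by rewrite /phi /cochain_frobenius Ey // expr0n; case: (p) p_gt0.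
have : coboundary_mod d E M 0 n (g *: phi y).
  apply: (connected_coboundary cplx codim_addK (leqnn c) Ephiz (connected_twisted_frobenius zy)).
  by exists b; [exact: Eb|exact: (cochain_modE _).1 Mb].
move=> /(coboundary_top Egy); rewrite cochainZ /phi /cochain_frobenius.
have [a [e [ae yE]]] := ly; rewrite yE loc_fracX loc_scaleE => /top_boundaryE ga.
have [N [bs [lam lamP]]] := pth_power_coordinates_exist hp hfin.
have killP b' : power_ideal k n e (b' * a) <-> coboundary_mod d E M 0 n (b' *: y).
  rewrite coboundary_top; last exact: (submoduleZ (cochain_degree_pred_submodule _ _)).
  by rewrite cochainZ yE loc_scaleE; symmetry; apply: top_boundaryE.
(* The annihilator of y in H^n(S). *)
pose ann_pred : set S := fun b' => power_ideal k n e (b' * a).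
have annP : is_ideal ann_pred.
  split; rewrite /ann_pred; first by rewrite mul0r; apply: ideal0.
    by move=> u v Iu Iv; rewrite mulrDl; apply: idealD.
  by move=> u v Iv; rewrite -mulrA; apply: ideal_mull.
have tau_ann : ideal_le tau (Ideal annP).
  apply: tauP.2; split; last first.
    apply/(frobenius_powerP hp lamP) => i r.
    suff: power_ideal k n e (frobenius_coordinate lam i r g * a) by [].
    rewrite mulrC -(coordinate_linear hp lamP) mulrC.
    exact: (coordinate_power_ideal hp lamP).
  move=> b' Jb'; apply/killP.
  apply: (connected_coboundary cplx codim_addK (leqnn c) _ (connected_scale cplx b' zy)).
    exact: (submoduleZ (cochain_degree_pred_submodule _ _)).
  exists 0; first exact: (submodule0 (cochain_degree_pred_submodule _ _)).
  rewrite raddf0 subr0 => I; rewrite cochainZ; have [u [e' ->]] := loc_fracE (z I).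
  rewrite loc_scaleE; exists (b' * u), e'; split=> //.
  exact/ideal_mulr/JE.
have : power_ideal k n e a.
  apply: (@power_ideal_low_degree _ _ l) => [mu /ae|s b' ls sb'].
    by lia.
  exact: tau_ann (powl s ls b' sb').
move=> /top_boundaryE; rewrite -yE => /(coboundary_top Ey) By.
have [b0 Eb0 Mb0] := connected_injective cplx acyclic_variables codim_addK (leqnn c) Ez zy By.
apply/(cohomology_class_eq0 zE); exists b0; [exact: Eb0|exact: (cochain_modE _).2 Mb0].
Qed.

Lemma frobenius_piece s h :
  cohomology_piece (@quot_piece k n J) (x := Xb) (i := j) s h ->
  cohomology_piece (@quot_piece k n J) (x := Xb) (i := j) (p%:Z * s)
    (@frobenius_action k n J p hp j h).
Proof.
move=> [cb [hcb ->]]; exists (cocycle_frobenius (quot_char_p J hp) cb); split; last first.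
  by rewrite /frobenius_action cohomology_frobeniusE.
move=> I; rewrite /= /cochain_frobenius; have [->|] := hcb I.
  by left; rewrite expr0n; case: (p) p_gt0.
move=> [e [r [_ [[a ha <-] er ->]]]]; right.
exists (e * p)%N, (r * p)%N, (quot_map J a ^+ p); split; last by rewrite loc_fracX.
  by exists (a ^+ p); [exact: dhomogMn|rewrite quot_mapX].
by move: er; rewrite !PoszM => ->; ring.
Qed.

Lemma frobenius_lt t h : local_cohomology_lt t h ->
  local_cohomology_lt (p%:Z * t) (@frobenius_action k n J p hp j h).
Proof.
move=> [N [s [g [gP ->]]]].
exists N, (fun i => p%:Z * s i), (fun i => @frobenius_action k n J p hp j (g i)).
split=> [i|].
  have [si gi] := gP i; split; last exact: frobenius_piece.
  by rewrite ltr_pM2l.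
exact: (raddf_sum (@cohomology_frobenius _ _ Xb p (quot_char_p J hp) j)).
Qed.

End CompleteIntersection.

Theorem theoremA (k : fieldType) (p : nat) (hp : p \in [pchar k])
  (hfin : finite_over_pth_powers k p) (n c : nat)
  (f : 'I_c -> {mpoly k[n.+1]}) (deg : 'I_c -> nat)
  (hdeg : forall i, (0 < deg i)%N)
  (hhom : forall i, f i \is (deg i).-homog)
  (hreg : regular_sequence f) :
  let J : ideal {mpoly k[n.+1]} := span_family f in
  let m : ideal {mpoly k[n.+1]} := irrelevant_ideal k n.+1 in
  let g : {mpoly k[n.+1]} := (\prod_(i < c) f i) ^+ p.-1 in
  let a : int := - (n.+1)%:Z + \sum_(i < c) (deg i)%:Z in
  let F := @frobenius_action k n.+1 J p hp (n.+1 - c) in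
  let H_lt := @local_cohomology_lt k n.+1 J (n.+1 - c) in
  let is_tau := smallest_ideal
    (fun I : ideal {mpoly k[n.+1]} => ideal_le J I /\ frobenius_power p I g) in
  let is_ell (tau : ideal {mpoly k[n.+1]}) :=
    is_max_nat (fun s => ~ ideal_le (ideal_pow m s) tau) in
  (forall P : ideal {mpoly k[n.+1]}, prime_ideal P ->
     (P : {mpoly k[n.+1]} -> Prop) <> m -> ideal_le J P ->
     ~ frobenius_power p P g) ->
  frobenius_power p m g ->
  (exists tau, is_tau tau) /\
  forall tau, is_tau tau ->
    [/\ radical tau = m,
        exists l, is_ell tau l
      & forall l, is_ell tau l ->
          (forall h, H_lt (a - l%:Z) h -> H_lt (p%:Z * (a - l%:Z)) (F h)) /\
          (forall h h', H_lt (a - l%:Z) h -> H_lt (a - l%:Z) h' ->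
             F h = F h' -> h = h')].
Proof.
move=> J m g a F H_lt is_tau is_ell prime_avoid gm.
pose dg (i : nat) := oapp deg 1%N (insub i).
have dgE (i : 'I_c) : dg i = deg i by rewrite /dg valK.
have fs_homog i : extend_seq f i \is (dg i).-homog.
  by rewrite /extend_seq /dg; case: insub => [i'|] /=; [exact: hhom|exact: dhomog0].
have dg_gt0 i : (i < c)%N -> (0 < dg i)%N.
  by rewrite /dg; case: insub => [i'|] //=.
have fs_reg := regular_sequence_partial hreg.
have JE b : J b <-> initial_ideal (extend_seq f) c b by apply: span_family_extend.
have Jm : ideal_le J m.
  apply: span_le => _ [i _ <-]; rewrite -extend_seqE.
  exact: (homog_positive_irrelevant fs_homog dg_gt0).
split; first exact: smallest_root_exists.
move=> tau tauP; split.
- exact: (radical_smallest_root prime_avoid (conj Jm gm) tauP).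
- exact: (socle_bound_exists prime_avoid (conj Jm gm) tauP).
move=> l [_ lmax]; split=> [h|h h' lh lh' Fhh']; first exact: frobenius_lt.
have aE : a - l%:Z = - (n.+1)%:Z + (\sum_(i < c) dg i)%N%:Z - l%:Z.
  rewrite /a; congr (_ + _ - _).
  rewrite (big_morph Posz PoszD erefl).
  by apply: eq_bigr => i _; rewrite dgE.
rewrite aE in lh lh'.
have rep := represented_lt fs_homog dg_gt0 fs_reg JE.
have := represented_add fs_reg (rep _ _ lh) (represented_opp fs_reg (rep _ _ lh')).
move=> /(frobenius_injective_lt fs_homog dg_gt0 fs_reg JE hfin) inj.
apply/eqP; rewrite -subr_eq0; apply/eqP; apply: (inj hp tau).
- by rewrite prod_extend.
- move=> s ls; have [//|/lmax] := pselect (ideal_le (ideal_pow m s) tau).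
  by rewrite leqNgt ls.
- have FB : F (h - h') = F h - F h'.
    exact: cohomology_frobenius_is_zmod_morphism.
  by rewrite -[LHS]/(F (h - h')) FB Fhh' subrr.
Qed.
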